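(* Let $\Lambda=\mathrm{diag}(\lambda_1,\dots,\lambda_n)\in\mathbb{R}^{n\times n}$ with $\lambda_k<0$ for $k\in\{1,\dots,m\}$ and $\lambda_k>0$ for $k\in\{m+1,\dots,n\}$, let $\Lambda^+=\mathrm{diag}(|\lambda_1|,\dots,|\lambda_n|)$, let $F\in\mathbb{R}^{n\times n}$, and let $G=\begin{pmatrix} G_{--} & G_{-+} \\ G_{+-} & G_{++} \end{pmatrix}\in\mathbb{R}^{n\times n}$ with $G_{--}\in\mathbb{R}^{m\times m}$, $G_{-+}\in\mathbb{R}^{m\times(n-m)}$, $G_{+-}\in\mathbb{R}^{(n-m)\times m}$, $G_{++}\in\mathbb{R}^{(n-m)\times(n-m)}$. Assume that there exist $\nu>0$, $\mu\in\mathbb{R}$ and symmetric positive definite matrices $Q^-\in\mathbb{R}^{m\times m}$ and $Q^+\in\mathbb{R}^{(n-m)\times(n-m)}$ such that, setting for each $x\in[0,1]$ $\mathcal{Q}(x)=\mathrm{diag}[e^{2\mu x}Q^-,e^{-2\mu x}Q^+]$ (block diagonal), one has, for all $x\in[0,1]$, $\mathcal{Q}(x)\Lambda=\Lambda\mathcal{Q}(x)$ and $$-2\mu\,\mathcal{Q}(x)\Lambda^++F^\top\mathcal{Q}(x)+\mathcal{Q}(x)F\le-2\nu\,\mathcal{Q}(x),$$ and $$\begin{pmatrix} I_m & 0_{m,n-m} \\ G_{+-} & G_{++} \end{pmatrix}^\top\mathcal{Q}(0)\Lambda\begin{pmatrix} I_m & 0_{m,n-m} \\ G_{+-} & G_{++}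 \end{pmatrix}\le\begin{pmatrix} G_{--} & G_{-+} \\ 0_{n-m,m} & I_{n-m} \end{pmatrix}^\top\mathcal{Q}(1)\Lambda\begin{pmatrix} G_{--} & G_{-+} \\ 0_{n-m,m} & I_{n-m} \end{pmatrix}.$$ Then there exists $C>0$ such that, for every $y^0\in L^2((0,1);\mathbb{R}^n)$, the solution $y$ of the initial value problem $$\partial_ty(t,x)+\Lambda\partial_xy(t,x)=Fy(t,x),\quad\begin{pmatrix} y^-(t,1) \\ y^+(t,0) \end{pmatrix}=G\begin{pmatrix} y^-(t,0) \\ y^+(t,1) \end{pmatrix},\quad y(0,x)=y^0(x)$$ ($x\in[0,1]$, $t\ge0$) satisfies $$\|y(t,\cdot)\|_{L^2((0,1);\mathbb{R}^n)}\le Ce^{-\nu t}\|y^0\|_{L^2((0,1);\mathbb{R}^n)}\quad\text{for all }t\ge0;$$ in particular the linear hyperbolic system is globally exponentially stable.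
   Context: Here $0\le m\le n$; blocks of size zero are omitted. For symmetric matrices, $A\le B$ means $B-A$ is positive semidefinite. $I_p$ is the $p\times p$ identity and $0_{p,q}$ the $p\times q$ zero matrix. Vectors are split as $y=\begin{pmatrix} y^- \\ y^+ \end{pmatrix}$ with $y^-\in\mathbb{R}^m$, $y^+\in\mathbb{R}^{n-m}$. Solutions: for every $y^0\in L^2((0,1);\mathbb{R}^n)$ the initial value problem has a unique weak solution $y\in C^0(\mathbb{R}_+;L^2((0,1);\mathbb{R}^n))$ (known fact), and ''the solution'' means this one. A weak solution is a $y\in C^0(\mathbb{R}_+;L^2((0,1);\mathbb{R}^n))$ with $y(0,\cdot)=y^0$ such that for every $T>0$ and every $\varphi\in C^1([0,T]\times[0,1];\mathbb{R}^n)$ satisfying the adjoint boundary condition $\Lambda^+\begin{pmatrix} \varphi^-(t,0) \\ \varphi^+(t,1) \end{pmatrix}=G^\top\Lambda^+\begin{pmatrix} \varphi^-(t,1) \\ \varphi^+(t,0) \end{pmatrix}$ for all $t\in[0,T]$, one has $\int_0^1\varphi(T,x)^\top y(T,x)\,dx-\int_0^1\varphi(0,x)^\top y^0(x)\,dx=\int_0^T\!\!\int_0^1(\partial_t\varphi+\Lambda\partial_x\varphi+F^\top\varphi)^\top y\,dx\,dt$. Globally exponentially stable (GES): there exist $\nu>0$ and $C>0$ such that for every $y^0\in L^2((0,1);\mathbb{R}^n)$ the solution satisfies $\|y(t,\cdot)\|_{L^2}\le Ce^{-\nu t}\|y^0\|_{L^2}$ for all $t\ge0$. *)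

(* Defs.v *)
From HB Require Import structures.
From mathcomp Require Import all_boot all_order all_algebra.
From mathcomp Require Import all_classical all_reals all_analysis.

Set Implicit Arguments.
Unset Strict Implicit.
Unset Printing Implicit Defensive.

Import Order.TTheory GRing.Theory Num.Theory.
Import numFieldNormedType.Exports.

Local Open Scope classical_set_scope.
Local Open Scope ring_scope.

Definition dotcv (R : realType) (n : nat) (u v : 'cV[R]_n) : R :=
  (u^T *m v) 0 0.

Definition posdef (R : realType) (n : nat) (A : 'M[R]_n) : Prop :=
  A^T = A /\ forall v : 'cV[R]_n, v != 0 -> 0 < dotcv v (A *m v).

Definition possemidef (R : realType) (n : nat) (A : 'M[R]_n) : Prop :=
  A^T = A /\ forall v : 'cV[R]_n, 0 <= dotcv v (A *m v).

Definition loewner_le (R : realType) (n : nat) (A B : 'M[R]_n) : Prop :=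
  possemidef (B - A).

(* Elements of L^2((0,1); R^n) are represented by functions on the whole real
   line, of which only the values on the open interval are relevant. *)
Definition L2_01 (R : realType) (n : nat) (f : R -> 'cV[R]_n) : Prop :=
  forall i : 'I_n,
    measurable_fun (`]0, 1[%classic : set R) (fun x => f x i 0) /\
    (@lebesgue_measure R).-integrable `]0, 1[ (fun x => ((f x i 0) ^+ 2)%:E).

(* The norm on matrices provided by the library is the sup norm; here the
   pointwise norm is the Euclidean one. *)
Definition L2norm (R : realType) (n : nat) (f : R -> 'cV[R]_n) : R :=
  Num.sqrt (\int[@lebesgue_measure R]_(x in `]0, 1[) dotcv (f x) (f x)).

(* y in C^0([0, +oo); L^2((0,1); R^n)); at 0 the limit is one-sided. *)
Definition C0_L2 (R : realType) (n : nat) (y : R -> R -> 'cV[R]_n) : Prop :=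
  (forall t, 0 <= t -> L2_01 (y t)) /\
  (forall t, 0 <= t ->
     L2norm (fun x => y s x - y t x) @[s --> within [set s | 0 <= s] (nbhs t)]
       --> (0 : R)).

(* phi is C^1 on the closed rectangle [0,T] x [0,1]: it is continuous there,
   and its partial derivatives in the open rectangle extend to the functions
   dtphi and dxphi, continuous on the closed one. *)
Definition C1_rectangle (R : realType) (n : nat) (T : R)
    (phi dtphi dxphi : R -> R -> 'cV[R]_n) : Prop :=
  let rect : set (R * R) := `[0, T] `*` `[0, 1] in
  forall i : 'I_n,
    [/\ {within rect, continuous (fun z : R * R => phi z.1 z.2 i 0)},
        {within rect, continuous (fun z : R * R => dtphi z.1 z.2 i 0)},
        {within rect, continuous (fun z : R * R => dxphi z.1 z.2 i 0)} &
        forall t x : R, 0 < t < T -> 0 < x < 1 ->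
          is_derive t 1 (fun s : R => phi s x i 0) (dtphi t x i 0) /\
          is_derive x 1 (fun z : R => phi t z i 0) (dxphi t x i 0)].

(* With n = m + p, y^- and y^+ are usubmx y and dsubmx y. *)

Definition Lam (R : realType) (m p : nat) (lambda : 'rV[R]_(m + p)) :
  'M[R]_(m + p) := diag_mx lambda.

Definition Lam_plus (R : realType) (m p : nat) (lambda : 'rV[R]_(m + p)) :
  'M[R]_(m + p) := diag_mx (\row_k `|lambda 0 k|).

Definition adjoint_bc (R : realType) (m p : nat) (lambda : 'rV[R]_(m + p))
    (G : 'M[R]_(m + p)) (T : R) (phi : R -> R -> 'cV[R]_(m + p)) : Prop :=
  forall t, 0 <= t <= T ->
    Lam_plus lambda *m col_mx (usubmx (phi t 0)) (dsubmx (phi t 1)) =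
    G^T *m Lam_plus lambda *m col_mx (usubmx (phi t 1)) (dsubmx (phi t 0)).

(* The double integral is iterated: for y in C0_L2 the inner integral is a
   continuous function of t, whereas joint measurability of the chosen
   representatives of the y t is not guaranteed. *)
Definition weak_solution (R : realType) (m p : nat) (lambda : 'rV[R]_(m + p))
    (F G : 'M[R]_(m + p)) (y0 : R -> 'cV[R]_(m + p))
    (y : R -> R -> 'cV[R]_(m + p)) : Prop :=
  [/\ C0_L2 y,
      {ae @lebesgue_measure R, forall x, 0 < x < 1 -> y 0 x = y0 x} &
      forall (T : R) (phi dtphi dxphi : R -> R -> 'cV[R]_(m + p)),
        0 < T -> C1_rectangle T phi dtphi dxphi ->
        adjoint_bc lambda G T phi ->
        \int[@lebesgue_measure R]_(x in `]0, 1[) dotcv (phi T x) (y T x) -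
        \int[@lebesgue_measure R]_(x in `]0, 1[) dotcv (phi 0 x) (y0 x) =
        \int[@lebesgue_measure R]_(t in `]0, T[)
          \int[@lebesgue_measure R]_(x in `]0, 1[)
            dotcv (dtphi t x + Lam lambda *m dxphi t x + F^T *m phi t x)
                  (y t x)].

Definition GES (R : realType) (m p : nat) (lambda : 'rV[R]_(m + p))
    (F G : 'M[R]_(m + p)) : Prop :=
  exists nu C : R, [/\ 0 < nu, 0 < C &
    forall y0 : R -> 'cV[R]_(m + p), L2_01 y0 ->
    forall y : R -> R -> 'cV[R]_(m + p), weak_solution lambda F G y0 y ->
    forall t : R, 0 <= t ->
      L2norm (y t) <= C * expR (- nu * t) * L2norm y0].

Definition Qweight (R : realType) (m p : nat) (mu : R)
    (Qm : 'M[R]_m) (Qp : 'M[R]_p) (x : R) : 'M[R]_(m + p) :=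
  block_mx (expR (2 * mu * x) *: Qm) 0 0 (expR (- 2 * mu * x) *: Qp).

(* Main.v *)
(** The solution is tested against the adjoint semigroup. In the weight
    [P x = (Q x)^-1] the adjoint operator [Lam d/dx + F^T + nu] is dissipative:
    the interior inequality gives the bulk term, and an AM-GM duality turns the
    boundary inequality for [G] into the one for the adjoint boundary condition.
    A test function [g] is propagated backwards in time by an implicit Euler
    scheme for [Lam d/dx], explicit in the bounded term; each step is a decoupled
    ODE boundary value problem. The weak formulation and the continuity of
    [t |-> y t] make the error vanish with the step, so that [exp(nu T) y T]
    pairs with [g] no better than [y0] does. Density of C^1 functions vanishing
    at the end points then bounds its L^2 norm. *)

Require Import Defs.
From HB Require Import structures.
From mathcomp Require Import all_boot all_order all_algebra.
From mathcomp Require Import all_classical all_reals all_analysis.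
From mathcomp Require Import measurable_realfun ring lra.
Import Order.TTheory GRing.Theory Num.Theory.
Import numFieldNormedType.Exports.
Local Open Scope classical_set_scope.
Local Open Scope ring_scope.

Set Implicit Arguments.
Unset Strict Implicit.
Unset Printing Implicit Defensive.

(** * The implicit Euler scheme in a semi-inner product space *)

(** A weak solution is only continuous into L^2, so neither the time derivative of a Lyapunov
    functional nor the boundary traces of [y] make sense; all derivatives and traces are therefore
    taken on test functions. The inverse weight appears because pairing exchanges a norm with its
    dual: the supremum of the pairing with a function over test functions of [P]-norm at most one is
    the [Q]-norm of that function. The weak formulation is only used with test functions exp(nu t)
    psi(x), [psi] fixed; the motion in time comes from changing [psi] at each step. The bounded term
    is explicit because [F^T] would couple the components of the differential equations. This costs
    a defect h M (s1 - s) per step, of order h^2 as long as increments are of order h; this is why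
    [g] is taken in the domain of the generator and the norm of its image is followed through the
    iteration. The constant must not depend on the final time: bounds that depend on [T] enter the
    error only, and the error vanishes with the step while [T] is fixed. *)

(** The carrier [C] is there because the forms are integrals, additive on integrable functions only.
    The form is not definite, since a function on the whole line is not determined by its values on
    the open interval. *)
Definition semi_inner (R : realType) (V : lmodType R) (C : V -> Prop)
    (b : V -> V -> R) : Prop :=
  [/\ forall a x y, C x -> C y -> C (a *: x + y), C 0,
      forall x y, C x -> C y -> b x y = b y x,
      forall a x y z, C x -> C y -> C z -> b (a *: x + y) z = a * b x z + b y z
    & forall x, C x -> 0 <= b x x].

Definition snorm (R : realType) (V : lmodType R) (b : V -> V -> R) (x : V) : R :=
  Num.sqrt (b x x).

Section SemiInner.
Context {R : realType} {V : lmodType R} (C : V -> Prop) (b : V -> V -> R).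
Hypothesis hb : semi_inner C b.
Local Notation N := (snorm b).

Lemma semi_innerZ_closed a x : C x -> C (a *: x).
Proof. by case: hb => cl c0 _ _ _ Cx; rewrite -[_ *: _]addr0; apply: cl. Qed.

Lemma semi_innerD_closed x y : C x -> C y -> C (x + y).
Proof. by case: hb => cl c0 _ _ _ Cx Cy; rewrite -[x]scale1r; apply: cl. Qed.

Lemma semi_innerB_closed x y : C x -> C y -> C (x - y).
Proof.
by case: hb => cl c0 _ _ _ Cx Cy; rewrite addrC -scaleN1r; apply: cl.
Qed.

Lemma semi_innerDl x y z : C x -> C y -> C z -> b (x + y) z = b x z + b y z.
Proof. by case: hb => _ _ _ l _ Cx Cy Cz; rewrite -[x]scale1r l// mul1r scale1r. Qed.

Lemma semi_innerZl a x z : C x -> C z -> b (a *: x) z = a * b x z.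
Proof.
case: hb => _ c0 _ l _ Cx Cz; rewrite -[_ *: _]addr0 l//.
suff -> : b 0 z = 0 by rewrite addr0.
by have := l (-1) 0 0 z c0 c0 Cz; rewrite scaler0 addr0 mulN1r addNr.
Qed.

Lemma semi_innerDr x y z : C x -> C y -> C z -> b z (x + y) = b z x + b z y.
Proof.
case: (hb) => _ _ s _ _ Cx Cy Cz; have Cxy := semi_innerD_closed Cx Cy.
by rewrite s// semi_innerDl// (s z x)// (s z y).
Qed.

Lemma semi_innerZr a x z : C x -> C z -> b z (a *: x) = a * b z x.
Proof.
case: (hb) => _ _ s _ _ Cx Cz; have Cax := semi_innerZ_closed a Cx.
by rewrite s// semi_innerZl// (s z x).
Qed.

Lemma semi_inner_sqnormD a x y : C x -> C y ->
  b (x + a *: y) (x + a *: y) = b x x + 2 * a * b x y + a ^+ 2 * b y y.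
Proof.
move=> Cx Cy; have Cay := semi_innerZ_closed a Cy.
have Cs := semi_innerD_closed Cx Cay.
rewrite semi_innerDl// !semi_innerDr// !semi_innerZl// !semi_innerZr//.
by case: (hb) => _ _ s _ _; rewrite (s y x)//; ring.
Qed.

Lemma semi_inner_sqr x : C x -> N x ^+ 2 = b x x.
Proof. by move=> Cx; rewrite sqr_sqrtr//; case: hb => _ _ _ _; apply. Qed.

Lemma semi_inner_norm_ge0 x : 0 <= N x.
Proof. exact: sqrtr_ge0. Qed.

Lemma semi_inner_CS x y : C x -> C y -> b x y <= N x * N y.
Proof.
move=> Cx Cy; have [_ _ s _ pos] := hb.
have [byy|byy] := eqVneq (b y y) 0.
  (* If [b x y] is nonzero, adding this multiple of [y] to [x] gives a vector of square -1, against
     positivity. *)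
  have := semi_inner_sqnormD (- (b x x + 1) / (2 * b x y)) Cx Cy.
  rewrite /snorm byy sqrtr0 mulr0 mulr0 addr0 => E.
  have [->//|nz] := eqVneq (b x y) 0.
  have := pos _ (semi_innerD_closed Cx (semi_innerZ_closed (- (b x x + 1) / (2 * b x y)) Cy)).
  rewrite E; have -> : 2 * (- (b x x + 1) / (2 * b x y)) * b x y = - (b x x + 1).
    by field.
  by lra.
have y0 : 0 < b y y by rewrite lt_neqAle eq_sym byy pos.
have E := semi_inner_sqnormD (- b x y / b y y) Cx Cy.
have := pos _ (semi_innerD_closed Cx (semi_innerZ_closed (- b x y / b y y) Cy)).
rewrite E.
have -> : b x x + 2 * (- b x y / b y y) * b x y + (- b x y / b y y) ^+ 2 * b y y
   = (b x x * b y y - b x y ^+ 2) / b y y by field.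
rewrite pmulr_lge0 ?invr_gt0// subr_ge0 => H.
rewrite /snorm -sqrtrM ?pos//; apply: (le_trans (ler_norm _)).
by rewrite -sqrtr_sqr ler_sqrt// mulr_ge0 ?pos.
Qed.

Lemma semi_inner_normZ a x : C x -> N (a *: x) = `|a| * N x.
Proof.
move=> Cx; rewrite /snorm semi_innerZl ?semi_innerZr//; last exact: semi_innerZ_closed.
by rewrite mulrA -expr2 sqrtrM ?sqr_ge0// sqrtr_sqr.
Qed.

Lemma semi_inner_CS_abs x y : C x -> C y -> `|b x y| <= N x * N y.
Proof.
move=> Cx Cy; rewrite ler_norml semi_inner_CS// andbT lerNl.
rewrite -mulN1r -semi_innerZl//.
apply: le_trans (semi_inner_CS (semi_innerZ_closed _ Cx) Cy) _.
by rewrite semi_inner_normZ// normrN1 mul1r.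
Qed.

Lemma semi_inner_normD x y : C x -> C y -> N (x + y) <= N x + N y.
Proof.
move=> Cx Cy; have := semi_inner_sqnormD 1 Cx Cy; rewrite scale1r => E.
have := semi_inner_CS Cx Cy.
rewrite [N (x + y)]/snorm -[X in _ -> _ <= X]ger0_norm ?addr_ge0 ?semi_inner_norm_ge0//.
rewrite -sqrtr_sqr => H; apply: ler_wsqrtr; rewrite E.
by rewrite sqrrD !semi_inner_sqr//; lra.
Qed.

Lemma semi_inner_normN x : C x -> N (- x) = N x.
Proof. by move=> Cx; rewrite -scaleN1r semi_inner_normZ// normrN1 mul1r. Qed.

Lemma semi_inner_normB x y : C x -> C y -> N (x - y) <= N x + N y.
Proof.
move=> Cx Cy; rewrite -(semi_inner_normN Cy); apply: semi_inner_normD => //.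
by rewrite -scaleN1r; apply: semi_innerZ_closed.
Qed.

End SemiInner.

Section Euler.
Context {R : realType} {V : lmodType R} (C : V -> Prop) (b : V -> V -> R).
Hypothesis hb : semi_inner C b.
Local Notation N := (snorm b).
(* [A psi chi] : psi is in the domain of the generator, with image chi *)
Variables (A : V -> V -> Prop) (M : V -> V) (c h0 T m m0 : R).
(** [pair x t] stands for the pairing of a test vector with a trajectory at time [t]; [m] bounds it
    on [[0, T]] and [m0] at time 0. Only [m0] survives in the final estimate. *)
Variable pair : V -> R -> R.
Hypothesis A_C : forall s x, A s x -> C s /\ C x.
Hypothesis A_B : forall s x s' x', A s x -> A s' x' -> A (s - s') (x - x').
Hypothesis M_B : forall x y, M (x - y) = M x - M y.
Hypothesis c_ge0 : 0 <= c.
Hypothesis M_C : forall x, C x -> C (M x).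
Hypothesis M_bounded : forall x, C x -> N (M x) <= c * N x.
Hypothesis dissipative : forall s x, A s x -> b s (x + M s) <= 0.
Hypothesis h0_gt0 : 0 < h0.
Hypothesis solvable : forall h, 0 < h < h0 -> forall g, C g ->
  exists s x, A s x /\ s - h *: x = g.
Hypothesis T_gt0 : 0 < T.
Hypothesis m_ge0 : 0 <= m.
Hypothesis m0_ge0 : 0 <= m0.
Hypothesis pair_lin : forall a x y t, 0 <= t -> C x -> C y ->
  pair (a *: x + y) t = a * pair x t + pair y t.
Hypothesis pair_bounded : forall t x, 0 <= t <= T -> C x ->
  `|pair x t| <= m * N x.
Hypothesis pair_bounded0 : forall x, C x -> `|pair x 0| <= m0 * N x.
Hypothesis pair_weak : forall e, 0 < e -> exists2 eta, 0 < eta &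
  forall t h, 0 <= t -> 0 < h < eta -> t + h <= T -> forall s x, A s x ->
  `|pair s (t + h) - pair s t - h * pair (x + M s) (t + h)|
    <= h * e * N (x + M s).

(** The new state solves s1 - h x1 = s + h M s, that is, s1 - h (x1 + M s1) = s - h M (s1 - s): a
    fully implicit step for the dissipative [A + M], up to a small defect. Dissipativity at [s1 - s]
    bounds the increment, and at [s1] the norm. The norm grows by the defect only, not by a factor
    exp(c h), which keeps the final constant free of [T]. *)
Lemma euler_step h s x : 0 < h < h0 -> h * c <= 2^-1 -> A s x ->
  exists s1 x1, [/\ A s1 x1,
    s1 + h *: M (s1 - s) = s + h *: (x1 + M s1),
    N (s1 - s) <= 2 * h * N (x + M s),
    N (x1 + M s1) <= expR (4 * (h * c)) * N (x + M s) &
    N s1 <= N s + h * c * N (s1 - s)].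
Proof.
move=> hh hc Asx; have [Cs Cx] := A_C Asx.
have h_gt0 : 0 < h by case/andP: hh.
have CMs := M_C Cs.
have Cr : C (s + h *: M s).
  by apply: (semi_innerD_closed hb) => //; apply: (semi_innerZ_closed hb).
have [s1 [x1 [As1 E]]] := solvable hh Cr.
have [Cs1 Cx1] := A_C As1; have CMs1 := M_C Cs1.
have Cd : C (s1 - s) by apply: (semi_innerB_closed hb).
have CMd := M_C Cd.
have CB : C (x + M s) by apply: (semi_innerD_closed hb).
have CB1 : C (x1 + M s1) by apply: (semi_innerD_closed hb).
have Es1 : s1 = s + h *: M s + h *: x1.
  by move: E => /eqP; rewrite subr_eq => /eqP.
have Ed : s1 - s = h *: x1 + h *: M s.
  by rewrite Es1 -(addrA s) [s + _]addrC addrK addrC.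
have EB : s1 + h *: M (s1 - s) = s + h *: (x1 + M s1).
  rewrite M_B scalerBr scalerDr {1}Es1 -!addrA; congr (s + _).
  by rewrite addrCA; congr (_ + _); rewrite addrC subrK.
have EhB : h *: (x1 + M s1) = (s1 - s) + h *: M (s1 - s).
  by apply: (addrI s); rewrite -EB addrA addrCA subrr addr0.
have Nd0 : 0 <= N (s1 - s) := semi_inner_norm_ge0 b _.
have NB0 : 0 <= N (x + M s) := semi_inner_norm_ge0 b _.
have sqle z K : C z -> 0 <= K -> b z z <= N z * K -> N z <= K.
  move=> Cz K0 H; have : N z ^+ 2 <= N z * K by rewrite (semi_inner_sqr hb Cz).
  rewrite expr2 => {H}; have : 0 <= N z := semi_inner_norm_ge0 b z; rewrite le_eqVlt => /predU1P[<-//|z0].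
  by rewrite ler_pM2l.
have ChB : C (h *: (x + M s)) by apply: (semi_innerZ_closed hb).
have ChMd : C (h *: M (s1 - s)) by apply: (semi_innerZ_closed hb).
have NhMd : N (h *: M (s1 - s)) <= h * c * N (s1 - s).
  rewrite (semi_inner_normZ hb)// gtr0_norm// -mulrA.
  by rewrite ler_wpM2l ?M_bounded// ltW.
have NhB : N (h *: (x + M s)) = h * N (x + M s).
  by rewrite (semi_inner_normZ hb)// gtr0_norm.
have hc0 : 0 <= h * c by rewrite mulr_ge0// ltW.
have dB : N (s1 - s) <= h * N (x + M s) + h * c * N (s1 - s).
  (* Dissipativity is applied to
     (s1 - s) - h (A + M) (s1 - s) = h (x + M s) - h M (s1 - s). *)
  have Ad := A_B As1 Asx; have := dissipative Ad.
  have Cxx : C (x1 - x + M (s1 - s)).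
    by apply: (semi_innerD_closed hb) => //; apply: (semi_innerB_closed hb).
  have Edd : s1 - s = h *: (x1 - x + M (s1 - s)) +
      (h *: (x + M s) - h *: M (s1 - s)).
    by rewrite {1}Ed !scalerDr scalerN [RHS]addrACA subrr addr0 addrA subrK.
  have Crest : C (h *: (x + M s) - h *: M (s1 - s)).
    exact: (semi_innerB_closed hb).
  move=> diss; apply: sqle => //.
    by rewrite addr_ge0// ?mulr_ge0// ltW.
  rewrite {2}Edd (semi_innerDr hb)//; last exact: (semi_innerZ_closed hb).
  rewrite (semi_innerZr hb)// -[leRHS]add0r; apply: lerD.
    by rewrite pmulr_rle0.
  apply: le_trans (semi_inner_CS hb Cd Crest) _.
  rewrite ler_wpM2l//; apply: le_trans (semi_inner_normB hb ChB ChMd) _.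
  by rewrite NhB lerD2l.
exists s1, x1; split => //.
- nra.
- have : h * N (x1 + M s1) <= N (s1 - s) + h * c * N (s1 - s).
    rewrite -[h in h * N _](gtr0_norm h_gt0) -(semi_inner_normZ hb) => [|//].
    rewrite EhB; apply: le_trans (semi_inner_normD hb Cd ChMd) _.
    by rewrite lerD2l.
  move=> H; rewrite -(ler_pM2l h_gt0); apply: le_trans H _.
  (* With k = h c at most 1/2, the image norm is multiplied by at most (1 + k) / (1 - k) <= 1 + 4 k
     <= exp(4 k). *)
  have le1 : 1 + 4 * (h * c) <= expR (4 * (h * c)) by apply: expR_ge1Dx.
  rewrite [leRHS]mulrCA; apply: (@le_trans _ _ ((1 + 4 * (h * c)) * (h * N (x + M s)))).
    set k := h * c in hc hc0 dB *; set n1 := N (s1 - s) in dB Nd0 *.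
    set n2 := h * N _ in dB *.
    have n20 : 0 <= n2 by rewrite mulr_ge0// ltW.
    have q1 : 0 <= (1 + 2 * k) * (n2 + k * n1 - n1).
      by rewrite mulr_ge0 ?subr_ge0// addr_ge0// mulr_ge0.
    have q2 : 0 <= n1 * (k * (1 - 2 * k)).
      by rewrite mulr_ge0// mulr_ge0//; lra.
    have n1b : n1 <= (1 + 2 * k) * n2 by lra.
    have q3 : 0 <= (1 + k) * ((1 + 2 * k) * n2 - n1).
      by rewrite mulr_ge0 ?subr_ge0// addr_ge0.
    have q4 : 0 <= n2 * (k * (1 - 2 * k)).
      by rewrite mulr_ge0// mulr_ge0//; lra.
    by lra.
  by rewrite ler_wpM2r ?mulr_ge0 ?(ltW h_gt0).
- apply: sqle => //.
    by rewrite addr_ge0 ?semi_inner_norm_ge0// mulr_ge0.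
  have -> : b s1 s1 = h * b s1 (x1 + M s1) + b s1 (s - h *: M (s1 - s)).
    rewrite -(semi_innerZr hb)// -(semi_innerDr hb) => [|||//].
    + congr b; rewrite addrCA addrA -EB addrK //.
    + exact: (semi_innerZ_closed hb).
    + exact: (semi_innerB_closed hb).
  rewrite -[leRHS]add0r; apply: lerD; first by rewrite pmulr_rle0// dissipative.
  have Cr' : C (s - h *: M (s1 - s)) by exact: (semi_innerB_closed hb).
  apply: le_trans (semi_inner_CS hb Cs1 Cr') _.
  rewrite ler_wpM2l ?semi_inner_norm_ge0//.
  apply: le_trans (semi_inner_normB hb Cs ChMd) _.
  by rewrite lerD2l.
Qed.

(** After [j] steps the state is paired with the trajectory at time [T - h j]. One step changes the
    pairing by the error of the weak formulation at the new state, at most h e K, and by the defect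
    of the scheme, at most 2 h^2 m c K; these add up by telescoping. [K] dominates the image norms
    of all steps because h n = T. *)
Lemma euler_iterate g x h n j e : 0 < h < h0 -> h * c <= 2^-1 -> A g x ->
  h * n%:R = T -> (j <= n)%N -> 0 <= e ->
  (forall t, 0 <= t -> t + h <= T -> forall s x, A s x ->
    `|pair s (t + h) - pair s t - h * pair (x + M s) (t + h)|
      <= h * e * N (x + M s)) ->
  let K := expR (4 * (T * c)) * N (x + M g) in
  exists s y, [/\ A s y, N (y + M s) <= expR (4 * (h * c) *+ j) * N (x + M g),
    N s <= N g + (h * j%:R) * (2 * h * c * K) &
    `|pair g T - pair s (T - h * j%:R)|
       <= h * j%:R * (2 * h * m * c * K + e * K)].
Proof.
move=> hh hc Agx hn jn e0 wk K.
have h_gt0 : 0 < h by case/andP: hh.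
elim: j jn => [|j IH] jn.
  exists g, x; split => //; first by rewrite mulr0n expR0 mul1r.
    by rewrite mulr0 mul0r addr0.
  by rewrite mulr0 subr0 subrr normr0 mul0r.
have [s [y [Asy By Ns Ps]]] := IH (ltnW jn).
have [s1 [y1 [As1 EB Nd NB Ns1]]] := euler_step hh hc Asy.
have [Cs Cy] := A_C Asy; have [Cs1 Cy1] := A_C As1.
have Nxg : 0 <= N (x + M g) by apply: semi_inner_norm_ge0.
have K0 : 0 <= K by rewrite mulr_ge0// expR_ge0.
have leK i : (i <= n)%N -> expR (4 * (h * c) *+ i) * N (x + M g) <= K.
  move=> ilen; rewrite ler_wpM2r// ler_expR -mulr_natr -hn.
  have -> : 4 * (h * n%:R * c) = 4 * (h * c) * n%:R by ring.
  by rewrite ler_wpM2l ?ler_nat// !mulr_ge0// ltW.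
have NB1 : N (y1 + M s1) <= expR (4 * (h * c) *+ j.+1) * N (x + M g).
  apply: le_trans NB _; rewrite [_ *+ j.+1]mulrS expRD -mulrA.
  by rewrite ler_wpM2l// expR_ge0.
have dK : N (s1 - s) <= 2 * h * K.
  apply: le_trans Nd _; rewrite ler_wpM2l//; first by rewrite mulr_ge0// ltW.
  exact: le_trans By (leK _ (ltnW jn)).
have hc0 : 0 <= h * c by rewrite mulr_ge0// ltW.
exists s1, y1; split => //.
  apply: le_trans Ns1 _; rewrite -natr1 mulrDr mulr1 mulrDl addrA.
  apply: lerD => //; apply: le_trans (ler_wpM2l hc0 dK) _.
  by rewrite le_eqVlt; apply/orP; left; apply/eqP; ring.
set t := T - h * j.+1%:R.
have tT : T - h * j%:R = t + h by rewrite /t -natr1; ring.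
have t0 : 0 <= t.
  rewrite /t -hn -mulrBr mulr_ge0 ?(ltW h_gt0)// subr_ge0 ler_nat//.
have thT : t + h <= T.
  by rewrite -tT lerBlDr lerDl mulr_ge0// ltW.
have th0 : 0 <= t + h by rewrite addr_ge0// ltW.
have := wk t t0 thT _ _ As1 => W; rewrite tT in Ps.
have CMd : C (M (s1 - s)) by apply: M_C; apply: (semi_innerB_closed hb).
have CB : C (y1 + M s1) by apply: (semi_innerD_closed hb) => //; apply: M_C.
have E : pair s (t + h) + h * pair (y1 + M s1) (t + h) =
         pair s1 (t + h) + h * pair (M (s1 - s)) (t + h).
  rewrite [LHS]addrC [RHS]addrC -!pair_lin//.
  by rewrite [h *: _ + s1]addrC EB addrC.
have b1 : `|h * pair (M (s1 - s)) (t + h)| <= h * (2 * h * m * c * K).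
  rewrite normrM gtr0_norm// ler_wpM2l ?(ltW h_gt0)//.
  have tt : 0 <= t + h <= T by rewrite th0.
  apply: le_trans (pair_bounded tt CMd) _.
  apply: le_trans (ler_wpM2l m_ge0 (M_bounded (semi_innerB_closed hb Cs1 Cs))) _.
  have := ler_wpM2l (mulr_ge0 m_ge0 c_ge0) dK.
  by move=> H; apply: le_trans (_ : m * c * (2 * h * K) <= _);
    [rewrite mulrA|rewrite le_eqVlt; apply/orP; left; apply/eqP; ring].
have b2 : h * e * N (y1 + M s1) <= h * e * K.
  rewrite ler_wpM2l ?mulr_ge0 ?(ltW h_gt0)//.
  exact: le_trans NB1 (leK _ jn).
have -> : pair g T - pair s1 t = (pair g T - pair s (t + h)) +
   (pair s1 (t + h) - pair s1 t - h * pair (y1 + M s1) (t + h)) +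
   h * pair (M (s1 - s)) (t + h).
  move: E; set a1 := pair s _; set a2 := pair (y1 + _) _; set a3 := pair s1 (t + h).
  set a4 := pair (M _) _ => E.
  have -> : a1 = a3 + h * a4 - h * a2 by rewrite -E addrK.
  ring.
apply: le_trans (ler_normD _ _) _; apply: le_trans (lerD (ler_normD _ _) b1) _.
have := lerD Ps (le_trans W b2); rewrite -natr1; lra.
Qed.

Lemma euler_bound g x : A g x -> `|pair g T| <= m0 * N g.
Proof.
move=> Agx; have [Cg Cx] := A_C Agx.
pose K := expR (4 * (T * c)) * N (x + M g).
have K0 : 0 <= K by rewrite mulr_ge0 ?expR_ge0// semi_inner_norm_ge0.
(* [e * L] is the total error over time [T] (defect of the pairing, plus [m0] times the growth of
   the norm) once the step is replaced by the larger [e]. Hence [h] is taken below [e], and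
   [e = e' / (L + 1)] gives [e * L <= e']. *)
pose L := T * (2 * m0 * c * K + 2 * m * c * K + K).
have L0 : 0 <= L.
  rewrite /L; move: (K) K0 => k k0; rewrite mulr_ge0 ?(ltW T_gt0)//.
  by rewrite addr_ge0// addr_ge0// !mulr_ge0.
apply/ler_addgt0Pr => e' e'0; pose e := e' / (L + 1).
have L1 : 0 < L + 1 by apply: ltr_wpDl.
have e0 : 0 < e by rewrite divr_gt0.
have [eta eta0 W] := pair_weak e0.
(* The last entry ensures h c <= 1/2. The integer [n] is chosen so that [h = T / n] lies below [d]
   and divides [T] exactly. *)
pose d := Num.min (Num.min h0 eta) (Num.min e (2 * (c + 1))^-1).
have c1 : 0 < 2 * (c + 1) by rewrite mulr_gt0// ltr_wpDl.
have d0 : 0 < d by rewrite !lt_min h0_gt0 eta0 e0 invr_gt0.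
pose n := (Num.truncn (T / d)).+1.
have n0 : 0 < n%:R :> R by rewrite ltr0n.
pose h := T / n%:R.
have h_gt0 : 0 < h by rewrite divr_gt0.
have hd : h < d.
  rewrite ltr_pdivrMr// mulrC -ltr_pdivrMr//.
  by apply: Num.Theory.truncnS_gt.
move: (hd); rewrite !lt_min => /andP[/andP[hh0 heta] /andP[he hc]].
have hc2 : h * c <= 2^-1.
  have : h * (2 * (c + 1)) < 1 by rewrite -ltr_pdivlMr// mul1r.
  by nra.
have hn : h * n%:R = T by rewrite /h divfK// gt_eqF.
have hh : 0 < h < h0 by rewrite h_gt0.
have heta' : 0 < h < eta by rewrite h_gt0.
have [s [y [As By Ns Ps]]] := euler_iterate hh hc2 Agx hn (leqnn n) (ltW e0)
  (fun t t0 tT => W t h t0 heta' tT).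
rewrite -/K in Ns Ps; rewrite hn subrr in Ns Ps.
have [Cs Cy] := A_C As.
have P0 := le_trans (pair_bounded0 Cs) (ler_wpM2l m0_ge0 Ns).
have -> : pair g T = (pair g T - pair s 0) + pair s 0 by rewrite subrK.
apply: le_trans (ler_normD _ _) _; apply: le_trans (lerD Ps P0) _.
have eL : e * L <= e'.
  by rewrite /e mulrAC -mulrA ler_piMr ?(ltW e'0)// ler_pdivrMr// mul1r lerDl.
suff : T * (2 * h * m * c * K + e * K) + m0 * (T * (2 * h * c * K)) <= e * L.
  by move=> H; move: (le_trans H eL); lra.
have E : e * L = T * (2 * e * m * c * K + e * K) + m0 * (T * (2 * e * c * K)).
  by rewrite /L; ring.
rewrite E; have := ltW he => {}he.
apply: lerD.
  rewrite ler_wpM2l ?(ltW T_gt0)// lerD2r.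
  by rewrite !ler_wpM2r// ler_wpM2l.
rewrite ler_wpM2l// ler_wpM2l ?(ltW T_gt0)//.
by rewrite !ler_wpM2r// ler_wpM2l.
Qed.
End Euler.

(** * Euclidean and L^2 inner products *)

Lemma dotcvE (R : realType) n (u v : 'cV[R]_n) : dotcv u v = \sum_i u i 0 * v i 0.
Proof. by rewrite /dotcv mxE; apply: eq_bigr => i _; rewrite mxE. Qed.

Lemma dotcvC (R : realType) n (u v : 'cV[R]_n) : dotcv u v = dotcv v u.
Proof. by rewrite !dotcvE; apply: eq_bigr => i _; rewrite mulrC. Qed.

Lemma dotcvDl (R : realType) n (u v w : 'cV[R]_n) :
  dotcv (u + v) w = dotcv u w + dotcv v w.
Proof. by rewrite /dotcv linearD mulmxDl mxE. Qed.

Lemma dotcvZl (R : realType) n a (u w : 'cV[R]_n) :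
  dotcv (a *: u) w = a * dotcv u w.
Proof. by rewrite /dotcv linearZ -scalemxAl mxE. Qed.

Lemma dotcvDr (R : realType) n (u v w : 'cV[R]_n) :
  dotcv u (v + w) = dotcv u v + dotcv u w.
Proof. by rewrite /dotcv mulmxDr mxE. Qed.

Lemma dotcvZr (R : realType) n a (u w : 'cV[R]_n) :
  dotcv u (a *: w) = a * dotcv u w.
Proof. by rewrite /dotcv -scalemxAr mxE. Qed.

Lemma dotcvBr (R : realType) n (u v w : 'cV[R]_n) :
  dotcv u (v - w) = dotcv u v - dotcv u w.
Proof. by rewrite dotcvDr -scaleN1r dotcvZr mulN1r. Qed.

Lemma subcvE (R : realType) n (u v : 'cV[R]_n) i : (u - v) i 0 = u i 0 - v i 0.
Proof. by rewrite !mxE. Qed.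

Lemma dotcv_ge0 (R : realType) n (u : 'cV[R]_n) : 0 <= dotcv u u.
Proof. by rewrite dotcvE sumr_ge0// => i _; rewrite -expr2 sqr_ge0. Qed.

Lemma dotcv_mulmx (R : realType) m n (u : 'cV[R]_m) (A : 'M[R]_(m, n)) v :
  dotcv u (A *m v) = dotcv (A^T *m u) v.
Proof. by rewrite /dotcv trmx_mul trmxK mulmxA. Qed.

Section L2.
Context {R : realType}.
Notation mu := (@lebesgue_measure R).

Lemma integrable01D (f g : R -> R) : mu.-integrable `]0, 1[ (EFin \o f) ->
  mu.-integrable `]0, 1[ (EFin \o g) ->
  mu.-integrable `]0, 1[ (EFin \o (fun x => f x + g x)).
Proof. by move=> fi gi; have := integrableD _ fi gi; apply => //. Qed.

Lemma integrable01Z (a : R) (f : R -> R) : mu.-integrable `]0, 1[ (EFin \o f) ->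
  mu.-integrable `]0, 1[ (EFin \o (fun x => a * f x)).
Proof. by move=> fi; have := integrableZl _ a fi; apply => //. Qed.

Lemma le_integrable01 (f g : R -> R) :
  measurable_fun (`]0, 1[%classic : set R) f ->
  (forall x, `|f x| <= g x) -> mu.-integrable `]0, 1[ (EFin \o g) ->
  mu.-integrable `]0, 1[ (EFin \o f).
Proof.
move=> mf fg gi; apply: (le_integrable _ _ _ gi) => //; first exact/measurable_EFinP.
by move=> x _ /=; rewrite lee_fin (le_trans (fg x))// ler_norm.
Qed.

Lemma integrable_mul_sqr (f g : R -> R) :
  measurable_fun (`]0, 1[%classic : set R) f ->
  mu.-integrable `]0, 1[ (fun x => ((f x) ^+ 2)%:E) ->
  measurable_fun (`]0, 1[%classic : set R) g ->
  mu.-integrable `]0, 1[ (fun x => ((g x) ^+ 2)%:E) ->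
  mu.-integrable `]0, 1[ (EFin \o (fun x => f x * g x)).
Proof.
move=> mf f2 mg g2.
apply: le_integrable01 (integrable01D f2 g2); first exact: measurable_funM.
move=> x /=; rewrite normrM.
have := sqr_ge0 (`|f x| - `|g x|); rewrite sqrrB !real_normK ?num_real//.
have := sqr_ge0 (f x); have := sqr_ge0 (g x).
have := mulr_ge0 (normr_ge0 (f x)) (normr_ge0 (g x)).
lra.
Qed.

Lemma cont_add (f g : R -> R) : continuous f -> continuous g ->
  continuous (fun x => f x + g x).
Proof. by move=> cf cg x; apply: cvgD; [exact: cf|exact: cg]. Qed.

Lemma cont_mul (f g : R -> R) : continuous f -> continuous g ->
  continuous (fun x => f x * g x).
Proof. by move=> cf cg x; apply: cvgM; [exact: cf|exact: cg]. Qed.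

Lemma cont_comp (f g : R -> R) : continuous f -> continuous g ->
  continuous (fun x => f (g x)).
Proof. by move=> cf cg x; apply: (cvg_comp _ _ (cg x) (cf _)). Qed.

Lemma cont_sum (I : finType) (F : I -> R -> R) :
  (forall i, continuous (F i)) -> continuous (fun x => \sum_i F i x).
Proof.
move=> cF; elim: (index_enum I) => [|i s IH].
  have -> : (fun x => \sum_(i <- [::]) F i x) = cst 0.
    by apply/funext => x; rewrite big_nil.
  exact: cst_continuous.
have -> : (fun x => \sum_(i <- i :: s) F i x) =
    (fun x => F i x + \sum_(i <- s) F i x).
  by apply/funext => x; rewrite big_cons.
exact: cont_add.
Qed.

Lemma continuous_integrable01 (f : R -> R) : continuous f ->
  mu.-integrable `]0, 1[ (EFin \o f).
Proof.
move=> cf; have : mu.-integrable `[0, 1] (EFin \o f).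
  apply: continuous_compact_integrable; first exact: segment_compact.
  exact: continuous_subspaceT.
by apply: integrableS => //; exact: subset_itv_oo_cc.
Qed.

Lemma continuous_measurable01 (f : R -> R) : continuous f ->
  measurable_fun (`]0, 1[%classic : set R) f.
Proof.
by move=> /continuous_integrable01 /measurable_int /measurable_EFinP.
Qed.

Lemma Rintegral01_cst (c : R) : \int[mu]_(x in `]0, 1[) c = c.
Proof.
rewrite Rintegral_cst; last exact: measurable_itv.
have := lebesgue_measure_itv `]0%R, 1%R[ => /= -> .
by rewrite lte_fin ltr01 /= oppr0 addr0 mulr1.
Qed.

Lemma Rintegral01_sum (I : finType) (f : I -> R -> R) :
  (forall i, mu.-integrable `]0, 1[ (EFin \o f i)) ->
  \int[mu]_(x in `]0, 1[) (\sum_i f i x) = \sum_i \int[mu]_(x in `]0, 1[) f i x.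
Proof.
move=> fi; suff [] : mu.-integrable `]0, 1[ (EFin \o (fun x => \sum_i f i x)) /\
  \int[mu]_(x in `]0, 1[) (\sum_i f i x) = \sum_i \int[mu]_(x in `]0, 1[) f i x by [].
elim: (index_enum I) => [|i s [IH1 IH2]].
  have -> : (fun x : R => \sum_(i <- [::]) f i x) = (fun=> 0).
    by apply/funext => x; rewrite big_nil.
  rewrite big_nil Rintegral01_cst; split => //.
  by apply: continuous_integrable01; apply: cst_continuous.
have -> : (fun x => \sum_(i <- i :: s) f i x) = (fun x => f i x + \sum_(i <- s) f i x).
  by apply/funext => x; rewrite big_cons.
by split; [exact: integrable01D|rewrite RintegralD// IH2 big_cons].
Qed.

Section vector.
Context {n : nat}.
Implicit Types f g : R -> 'cV[R]_n.

Lemma integrable_dotcv f g : L2_01 f -> L2_01 g ->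
  mu.-integrable `]0, 1[ (EFin \o (fun x => dotcv (f x) (g x))).
Proof.
move=> Lf Lg; have -> : EFin \o (fun x => dotcv (f x) (g x)) =
   (fun x => \sum_(i < n) (f x i 0 * g x i 0)%:E)%E.
  by apply/funext => x /=; rewrite dotcvE sumEFin.
apply: integrable_sum => // i _.
have [mf f2] := Lf i; have [mg g2] := Lg i; exact: integrable_mul_sqr.
Qed.

Lemma L2_01_lin a f g : L2_01 f -> L2_01 g -> L2_01 (a *: f + g).
Proof.
move=> Lf Lg i; have [mf f2] := Lf i; have [mg g2] := Lg i.
have E : (fun x => (a *: f + g) x i 0) = (fun x => a * f x i 0 + g x i 0).
  by apply/funext => x; rewrite !mxE.
have m1 : measurable_fun (`]0, 1[%classic : set R) (fun x => a * f x i 0 + g x i 0).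
  by apply: measurable_funD => //; apply: measurable_funM.
rewrite E; split => //.
have -> : (fun x => ((a *: f + g) x i 0 ^+ 2)%:E) =
    EFin \o (fun x => (a * f x i 0 + g x i 0) ^+ 2).
  by apply/funext => x; rewrite /= !mxE.
apply: le_integrable01 (integrable01D (integrable01Z (2 * a ^+ 2) f2)
  (integrable01Z 2 g2)); first exact: measurable_funX.
move=> x /=; rewrite ger0_norm ?sqr_ge0//.
by have := sqr_ge0 (a * f x i 0 - g x i 0); nra.
Qed.

Lemma L2_01_0 : L2_01 (0 : R -> 'cV[R]_n).
Proof.
move=> i.
have -> : (fun x : R => (0 : R -> 'cV[R]_n) x i 0) = cst 0.
  by apply/funext => x; rewrite mxE.
split; first exact: measurable_cst.
have -> : (fun x : R => (((0 : R -> 'cV[R]_n) x i 0) ^+ 2)%:E) = cst 0%E.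
  by apply/funext => x; rewrite mxE expr0n.
exact: integrable0.
Qed.

Definition L2dot f g : R := \int[mu]_(x in `]0, 1[) dotcv (f x) (g x).

Lemma semi_inner_L2 : semi_inner (@L2_01 R n) L2dot.
Proof.
split.
- exact: L2_01_lin.
- exact: L2_01_0.
- by move=> f g _ _; apply: eq_Rintegral => x _; rewrite dotcvC.
- move=> a f g h Lf Lg Lh.
  have -> : L2dot (a *: f + g) h =
      \int[mu]_(x in `]0, 1[) (a * dotcv (f x) (h x) + dotcv (g x) (h x)).
    by apply: eq_Rintegral => x _; rewrite dotcvDl dotcvZl.
  have I1 := integrable_dotcv Lf Lh; have I2 := integrable_dotcv Lg Lh.
  by rewrite RintegralD//; [rewrite RintegralZl|apply: integrable01Z].
- by move=> f _; apply: Rintegral_ge0 => x _; apply: dotcv_ge0.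
Qed.

Definition cont_cv f := forall i, continuous (fun x => f x i 0).

Lemma cont_cv_L2 f : cont_cv f -> L2_01 f.
Proof.
move=> cf i; split; first exact: continuous_measurable01.
apply: continuous_integrable01 .
exact: cont_mul.
Qed.

Lemma cont_cv_lin a f g : cont_cv f -> cont_cv g -> cont_cv (a *: f + g).
Proof.
move=> cf cg i.
have -> : (fun x => (a *: f + g) x i 0) = (fun x => a * f x i 0 + g x i 0).
  by apply/funext => x; rewrite !mxE.
by apply: cont_add => //; apply: cont_mul => //; apply: cst_continuous.
Qed.

Lemma cont_cvB f g : cont_cv f -> cont_cv g -> cont_cv (f - g).
Proof. by move=> cf cg; rewrite addrC -scaleN1r; apply: cont_cv_lin. Qed.

Lemma cont_cvD f g : cont_cv f -> cont_cv g -> cont_cv (f + g).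
Proof. by move=> cf cg; rewrite -[f]scale1r; apply: cont_cv_lin. Qed.

Lemma cont_cv0 : cont_cv (0 : R -> 'cV[R]_n).
Proof.
move=> i; have -> : (fun x : R => (0 : R -> 'cV[R]_n) x i 0) = cst 0.
  by apply/funext => x; rewrite mxE.
exact: cst_continuous.
Qed.

Definition cont_mx (W : R -> 'M[R]_n) := forall i j, continuous (fun x => W x i j).

Lemma cont_cv_mulmx (W : R -> 'M[R]_n) f :
  cont_mx W -> cont_cv f -> cont_cv (fun x => W x *m f x).
Proof.
move=> cW cf i; have -> : (fun x => (W x *m f x) i 0) =
   (fun x => \sum_j W x i j * f x j 0) by apply/funext => x; rewrite mxE.
by apply: cont_sum => j; apply: cont_mul.
Qed.

Lemma cont_dotcv f g : cont_cv f -> cont_cv g ->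
  continuous (fun x => dotcv (f x) (g x)).
Proof.
move=> cf cg; have -> : (fun x => dotcv (f x) (g x)) =
   (fun x => \sum_i f x i 0 * g x i 0) by apply/funext => x; rewrite dotcvE.
by apply: cont_sum => j; apply: cont_mul.
Qed.

Definition Wdot (W : R -> 'M[R]_n) f g : R :=
  \int[mu]_(x in `]0, 1[) dotcv (f x) (W x *m g x).

Lemma semi_inner_W (W : R -> 'M[R]_n) : cont_mx W ->
  (forall x, 0 < x < 1 -> possemidef (W x)) -> semi_inner cont_cv (Wdot W).
Proof.
move=> cW pW; split.
- exact: cont_cv_lin.
- exact: cont_cv0.
- move=> f g _ _; apply: eq_Rintegral => x; rewrite inE/= in_itv/= => x01.
  by rewrite dotcv_mulmx (pW _ x01).1 dotcvC.
- move=> a f g h Lf Lg Lh.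
  have cWh := cont_cv_mulmx cW Lh.
  have I1 := continuous_integrable01 (cont_dotcv Lf cWh).
  have I2 := continuous_integrable01 (cont_dotcv Lg cWh).
  have -> : Wdot W (a *: f + g) h =
      \int[mu]_(x in `]0, 1[) (a * dotcv (f x) (W x *m h x) + dotcv (g x) (W x *m h x)).
    by apply: eq_Rintegral => x _; rewrite dotcvDl dotcvZl.
  by rewrite RintegralD//; [rewrite RintegralZl|apply: integrable01Z].
- move=> f _; apply: Rintegral_ge0 => x; rewrite /= in_itv/= => x01.
  exact: (pW _ x01).2.
Qed.
End vector.
End L2.

(** * Quadratic forms and the exponential weight *)

Section Forms.
Context {R : realType}.

Lemma semi_inner_dotcv n : semi_inner (fun _ : 'cV[R]_n => True) (@dotcv R n).
Proof.
split => // [x y _ _|a x y z _ _ _|x _]; first exact: dotcvC.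
  by rewrite dotcvDl dotcvZl.
exact: dotcv_ge0.
Qed.

Lemma dotcv_CS n (u v : 'cV[R]_n) :
  dotcv u v ^+ 2 <= dotcv u u * dotcv v v.
Proof.
have := semi_inner_CS_abs (semi_inner_dotcv n) (x := u) (y := v) I I.
rewrite -ler_sqr ?nnegrE ?mulr_ge0 ?semi_inner_norm_ge0// exprMn.
by rewrite !(semi_inner_sqr (semi_inner_dotcv n))// real_normK ?num_real.
Qed.

(** Cauchy-Schwarz on each row; the constant is the squared Frobenius norm. *)
Lemma mulmx_bound m n (A : 'M[R]_(m, n)) : exists2 K, 0 <= K &
  forall v, dotcv (A *m v) (A *m v) <= K * dotcv v v.
Proof.
exists (\sum_i dotcv (row i A)^T (row i A)^T).
  by apply: sumr_ge0 => i _; apply: dotcv_ge0.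
move=> v; rewrite dotcvE mulr_suml; apply: ler_sum => i _.
have -> : (A *m v) i 0 = dotcv (row i A)^T v by rewrite /dotcv trmxK -row_mul [RHS]mxE.
by rewrite -expr2 dotcv_CS.
Qed.

(** Expanding the square of [v - A *m v] bounds twice the form by [1 + K] times the square of
    [v]. *)
Lemma quad_bound n (A : 'M[R]_n) : exists2 K, 0 <= K &
  forall v, dotcv v (A *m v) <= K * dotcv v v.
Proof.
have [K K0 AK] := mulmx_bound A; exists (1 + K); first by rewrite addr_ge0.
move=> v; have := dotcv_ge0 (v - A *m v).
have := AK v; have := dotcv_ge0 v.
rewrite -scaleN1r dotcvDl !dotcvDr !dotcvZl !dotcvZr (dotcvC (A *m v) v).
nra.
Qed.

Lemma posdef_unit n (A : 'M[R]_n) : posdef A -> A \in unitmx.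
Proof.
move=> [sA pA]; rewrite -row_free_unit; apply/inj_row_free => v vA0.
apply/eqP; apply: contraPT (erefl (0 : R)) => v0 _.
have vt0 : v^T != 0 by apply: contra_neq v0 => /(congr1 trmx); rewrite trmxK trmx0.
have := pA _ vt0; rewrite -[A]sA -trmx_mul vA0 trmx0 /dotcv mulmx0 mxE.
by rewrite ltxx.
Qed.

Lemma posdef_psd n (A : 'M[R]_n) : posdef A -> possemidef A.
Proof.
move=> [sA pA]; split => // v; have [->|/pA/ltW//] := eqVneq v 0.
by rewrite mulmx0 /dotcv mulmx0 mxE.
Qed.

Lemma posdef_inv n (A : 'M[R]_n) : posdef A -> posdef (invmx A).
Proof.
move=> pA; have uA := posdef_unit pA; have [sA qA] := pA.
split; first by rewrite trmx_inv sA.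
move=> v v0; have w0 : invmx A *m v != 0.
  by apply: contra_neq v0 => /(congr1 (mulmx A)); rewrite mulmxA mulmxV// mul1mx mulmx0.
by have := qA _ w0; rewrite mulmxA mulmxV// mul1mx dotcvC.
Qed.

Lemma dotcv_sym n (A : 'M[R]_n) u v : A^T = A -> dotcv u (A *m v) = dotcv v (A *m u).
Proof. by move=> sA; rewrite dotcv_mulmx sA dotcvC. Qed.

(* A matrix commuting with a positive diagonal one also commutes with its square root. *)
Lemma psd_mul_diag n (A : 'M[R]_n) (d : 'rV[R]_n) : possemidef A ->
  (forall i, 0 < d 0 i) -> A *m diag_mx d = diag_mx d *m A ->
  possemidef (A *m diag_mx d).
Proof.
move=> [sA pA] d0 cAd; split; first by rewrite trmx_mul tr_diag_mx sA cAd.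
move=> v; pose s := \col_i (Num.sqrt (d 0 i) * v i 0).
suff -> : dotcv v (A *m diag_mx d *m v) = dotcv s (A *m s) by [].
rewrite !dotcvE; apply: eq_bigr => i _.
have -> : (A *m diag_mx d *m v) i 0 = \sum_j A i j * d 0 j * v j 0.
  by rewrite mxE; apply: eq_bigr => j _; rewrite mul_mx_diag mxE.
have -> : (A *m s) i 0 = \sum_j A i j * s j 0 by rewrite mxE.
rewrite !mulr_sumr; apply: eq_bigr => j _; rewrite !mxE.
have := congr1 (fun B : 'M[R]_n => B i j) cAd.
rewrite mul_mx_diag mul_diag_mx !mxE => /eqP.
rewrite mulrC -subr_eq0 -mulrBl mulf_eq0 subr_eq0 => /orP[/eqP->|/eqP->]; last first.
  by rewrite !(mul0r, mulr0).
by rewrite -{1}[d 0 i]sqr_sqrtr ?ltW//; ring.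
Qed.

Lemma dotcv_col m p (a c : 'cV[R]_m) (b d : 'cV[R]_p) :
  dotcv (col_mx a b) (col_mx c d) = dotcv a c + dotcv b d.
Proof. by rewrite /dotcv tr_col_mx mul_row_col mxE. Qed.

(** Positivity of the form at [u - v]. *)
Lemma psd_amgm n (A : 'M[R]_n) u v : possemidef A ->
  2 * dotcv u (A *m v) <= dotcv u (A *m u) + dotcv v (A *m v).
Proof.
move=> [sA pA]; have := pA (u - v); rewrite -[- v]scaleN1r mulmxDr -scalemxAr.
rewrite dotcvDl !dotcvDr !dotcvZl !dotcvZr (dotcv_sym v u sA); lra.
Qed.

Lemma Qweight_mul_col m p mu (Qm : 'M[R]_m) (Qp : 'M[R]_p) x (a : 'cV[R]_m) (b : 'cV[R]_p) :
  Qweight mu Qm Qp x *m col_mx a b =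
  col_mx (expR (2 * mu * x) *: (Qm *m a)) (expR (- 2 * mu * x) *: (Qp *m b)).
Proof.
by rewrite /Qweight mul_block_col !mul0mx addr0 add0r -!scalemxAl.
Qed.

(** The inverse weight is again a [Qweight], so positivity, bounds and derivatives proved for
    [Qweight] also serve for the dual weight. *)
Lemma Qweight_mulV m p mu (Qm : 'M[R]_m) (Qp : 'M[R]_p) x : posdef Qm -> posdef Qp ->
  Qweight mu Qm Qp x *m Qweight (- mu) (invmx Qm) (invmx Qp) x = 1%:M.
Proof.
move=> /posdef_unit um /posdef_unit up.
rewrite /Qweight mulmx_block !mulmx0 !mul0mx !addr0 !add0r.
rewrite -!scalemxAl -!scalemxAr !mulmxV// !scalerA -!expRD.
have -> : 2 * mu * x + 2 * - mu * x = 0 by ring.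
have -> : - 2 * mu * x + - 2 * - mu * x = 0 by ring.
by rewrite expR0 !scale1r -scalar_mx_block.
Qed.

Lemma Qweight_psd m p mu (Qm : 'M[R]_m) (Qp : 'M[R]_p) x : posdef Qm -> posdef Qp ->
  possemidef (Qweight mu Qm Qp x).
Proof.
move=> /posdef_psd[sm pm] /posdef_psd[sp pp]; split.
  by rewrite /Qweight tr_block_mx !linearZ/= sm sp !trmx0.
move=> v; rewrite -[v]vsubmxK Qweight_mul_col dotcv_col !dotcvZr.
by rewrite addr_ge0// mulr_ge0 ?expR_ge0.
Qed.

Lemma expR_le_bound (mu x : R) : 0 <= x <= 1 -> expR (mu * x) <= expR `|mu|.
Proof.
move=> /andP[x0 x1]; rewrite ler_expR; apply: le_trans (ler_norm _) _.
by rewrite normrM (ger0_norm x0) ler_piMr.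
Qed.

Lemma Qweight_upper m p mu (Qm : 'M[R]_m) (Qp : 'M[R]_p) : posdef Qm -> posdef Qp ->
  exists2 K, 0 < K & forall x, 0 <= x <= 1 -> forall v,
    dotcv v (Qweight mu Qm Qp x *m v) <= K * dotcv v v.
Proof.
move=> /posdef_psd[_ pm] /posdef_psd[_ pp].
have [K1 K10 b1] := quad_bound Qm; have [K2 K20 b2] := quad_bound Qp.
have e0 : 0 <= expR `|2 * mu| := expR_ge0 _.
exists (expR `|2 * mu| * (K1 + K2 + 1)).
  by rewrite mulr_gt0 ?expR_gt0// ltr_wpDl// addr_ge0.
move=> x x01 v; rewrite -[v]vsubmxK Qweight_mul_col !dotcv_col !dotcvZr.
set a := usubmx v; set b := dsubmx v.
have := ler_wpM2r (pm a) (expR_le_bound (2 * mu) x01).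
have := ler_wpM2r (pp b) (expR_le_bound (- 2 * mu) x01).
rewrite mulNr normrN.
have := ler_wpM2l e0 (b1 a); have := ler_wpM2l e0 (b2 b).
have := dotcv_ge0 a; have := dotcv_ge0 b; move: (expR `|2 * mu|) e0 => E E0.
move: (dotcv a a) (dotcv b b) => aa bb b0 a0 h1 h2 h3 h4.
have := mulr_ge0 E0 (mulr_ge0 K20 a0); have := mulr_ge0 E0 (mulr_ge0 K10 b0).
have := mulr_ge0 E0 a0; have := mulr_ge0 E0 b0.
lra.
Qed.

(** Duality with the upper bound on the weight Q, without eigenvalues: AM-GM for Q at [K^-1 *: v]
    and [w = P v], where Q w = v, gives 2 K^-1 |v|^2 <= K^-2 v.Qv + v.Pv <= K^-1 |v|^2 + v.Pv. *)
Lemma Qweight_inv_lower m p mu (Qm : 'M[R]_m) (Qp : 'M[R]_p) : posdef Qm -> posdef Qp ->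
  exists2 K, 0 < K & forall x, 0 <= x <= 1 -> forall v,
    dotcv v v <= K * dotcv v (Qweight (- mu) (invmx Qm) (invmx Qp) x *m v).
Proof.
move=> pm pp; have [K K0 bK] := Qweight_upper mu pm pp.
exists K => // x x01 v.
set P := Qweight _ _ _ _; set w := P *m v.
have Qw : Qweight mu Qm Qp x *m w = v by rewrite /w mulmxA Qweight_mulV// mul1mx.
have psdQ := Qweight_psd mu x pm pp.
have := psd_amgm (K^-1 *: v) w psdQ.
rewrite Qw -scalemxAr !dotcvZl dotcvZr (dotcvC w) => am.
have Ki : 0 < K^-1 by rewrite invr_gt0.
have KK : K^-1 * K = 1 by rewrite mulVf// gt_eqF.
have := ler_wpM2l (ltW (mulr_gt0 Ki Ki)) (bK x x01 v).
have -> : K^-1 * K^-1 * (K * dotcv v v) = K^-1 * dotcv v v.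
  by rewrite mulrA -(mulrA K^-1) KK mulr1.
rewrite -mulrA => b1; rewrite -ler_pdivrMl//; lra.
Qed.
End Forms.

(** * Antiderivatives on the whole line *)

Section Calculus.
Context {R : realType}.
Notation mu := (@lebesgue_measure R).
Implicit Types f g F : R -> R.

(** Differentiability is asked at every real point, so that no one-sided derivatives at 0 and 1
    occur; test functions are built on the whole line and restricted under the integral. *)
Definition antideriv F f := forall x : R, is_derive x 1 F (f x).

Lemma antideriv_continuous F f : antideriv F f -> continuous F.
Proof.
move=> dF x; apply: differentiable_continuous; apply/derivable1_diffP.
by case: (dF x).
Qed.

Lemma antideriv_add F f G g : antideriv F f -> antideriv G g ->
  antideriv (fun x => F x + G x) (fun x => f x + g x).
Proof. by move=> dF dG x; apply: is_deriveD. Qed.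

Lemma antideriv_mul F f G g : antideriv F f -> antideriv G g ->
  antideriv (fun x => F x * G x) (fun x => f x * G x + F x * g x).
Proof.
move=> dF dG x; apply: is_derive_eq; first exact: is_deriveM.
by rewrite addrC; congr (_ + _); rewrite mulrC.
Qed.

Lemma antideriv_cst (a : R) : antideriv (fun=> a) (fun=> 0).
Proof. by move=> x; apply: is_derive_cst. Qed.

Lemma antideriv_scale a F f : antideriv F f ->
  antideriv (fun x => a * F x) (fun x => a * f x).
Proof.
move=> dF x; apply: is_derive_eq; first exact: (antideriv_mul (antideriv_cst a) dF).
by rewrite mul0r add0r.
Qed.

Lemma antideriv_sum (I : finType) (F f : I -> R -> R) :
  (forall i, antideriv (F i) (f i)) ->
  antideriv (fun x => \sum_i F i x) (fun x => \sum_i f i x).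
Proof.
move=> dF; elim: (index_enum I) => [|i s IH] x.
  have -> : (fun x => \sum_(i <- [::]) F i x) = cst 0.
    by apply/funext => y; rewrite big_nil.
  by rewrite big_nil; apply: is_derive_cst.
have -> : (fun x => \sum_(i <- i :: s) F i x) =
    (fun x => F i x + \sum_(i <- s) F i x).
  by apply/funext => y; rewrite big_cons.
by rewrite big_cons; exact: (antideriv_add (dF i) IH x).
Qed.

Lemma antideriv_expR (a : R) :
  antideriv (fun x => expR (a * x)) (fun x => a * expR (a * x)).
Proof.
have did : antideriv id (fun=> 1) by move=> x; apply: is_derive_id.
move=> x; have := is_derive1_comp (is_derive_expR (a * x)) (antideriv_scale a did x).
by rewrite mulr1 mulrC.
Qed.

Lemma Rintegral_antideriv F f (T : R) : 0 < T -> continuous f -> antideriv F f ->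
  \int[mu]_(x in `]0, T[) f x = F T - F 0.
Proof.
move=> T0 cf dF; have fi : mu.-integrable `[0, T] (EFin \o f).
  apply: continuous_compact_integrable; first exact: segment_compact.
  exact: continuous_subspaceT.
have fi1 : mu.-integrable `]0, T] (EFin \o f).
  by apply: integrableS fi => // z /=; rewrite !in_itv/= => /andP[/ltW-> ->].
have fi2 : mu.-integrable `]0, T[ (EFin \o f).
  by apply: integrableS fi => //; exact: subset_itv_oo_cc.
rewrite Rintegral_itv_bndo_bndc// Rintegral_itv_obnd_cbnd//.
rewrite /Rintegral (@continuous_FTC2 _ f F _ _ T0) => [//| | |].
- exact: continuous_subspaceT.
- have cF := antideriv_continuous dF; split.
  + by move=> x _; case: (dF x).
  + by apply: cvg_at_right_filter; apply: cF.
  + by apply: cvg_at_left_filter; apply: cF.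
- by move=> x _; rewrite derive1E; case: (dF x).
Qed.

(** The integral from a base point is differentiable to the right of that point only, so the base
    point [k x] moves to the left as [|x|] grows. Subtracting the integral up to 0 makes the value
    independent of the base point. *)
Lemma exists_antideriv f : continuous f -> exists F, antideriv F f.
Proof.
move=> cf.
have fi (a b : R) : mu.-integrable `[a, b] (EFin \o f).
  apply: continuous_compact_integrable; first exact: segment_compact.
  exact: continuous_subspaceT.
pose G (a x : R) : R := \int[mu]_(t in `[a, x]) f t.
have dG (a x : R) : a < x -> is_derive x 1 (G a) (f x).
  move=> ax; have x1 : x < x + 1 by rewrite ltrDl.
  have [d1 d2] := continuous_FTC1_closed x1 (fi a (x + 1)) ax (cf x).
  by apply: DeriveDef => //; rewrite -derive1E.
have split (a b x : R) : a <= b -> b <= x -> G a x = G a b + G b x.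
  move=> ab bx; apply/eqP; rewrite addrC -subr_eq; apply/eqP.
  rewrite /G (@Rintegral_itvB _ f (BLeft a) (BRight x) b)//.
  rewrite Rintegral_itv_obnd_cbnd//.
  by apply: integrableS (fi b x) => // z /=; rewrite !in_itv/= => /andP[/ltW-> ->].
pose k (x : R) := - (Num.truncn `|x|)%:R - 1 : R.
have kx (x : R) : k x < x.
  rewrite /k ltrBlDr ltrNl; have := Num.Theory.truncnS_gt `|x|.
  rewrite -natr1; have := ler_norm (- x); rewrite normrN; lra.
have k0 x : k x <= 0 by rewrite /k subr_le0 (le_trans _ ler01)// oppr_le0.
exists (fun x => G (k x) x - G (k x) 0) => x.
(* [a] lies to the left of [k y] for all [y] at distance less than 1 from [x]: near [x] one fixed
   base point can replace the moving ones. *)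
pose a := - (Num.truncn (`|x| + 1))%:R - 1 : R.
have ax y : `|x - y| < 1 -> a <= k y.
  move=> xy; rewrite /a /k lerD2r lerN2 ler_nat; apply: Num.Theory.le_truncn.
  rewrite -lerBlDl; apply: le_trans (ltW xy).
  by rewrite distrC; apply: le_trans (lerB_dist _ _).
have a0 : a <= 0 by rewrite /a subr_le0 (le_trans _ ler01)// oppr_le0.
apply: (@near_eq_is_derive _ _ _ (fun y => G a y - G a 0)).
  near=> y; have xy : `|x - y| < 1 by near: y; exact: (nbhsx_ballx x 1 ltr01).
  rewrite (split a (k y) y)// ?ax// ?(ltW (kx y))//.
  by rewrite (split a (k y) 0) ?ax// opprD addrACA subrr add0r.
have axx : a < x by apply: le_lt_trans (kx x); apply: ax; rewrite subrr normr0.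
apply: is_derive_eq; first exact: (is_deriveB (dG a x axx) (is_derive_cst _ _ _)).
by rewrite subr0.
Unshelve. all: by end_near. Qed.

Definition antideriv_cv n (F f : R -> 'cV[R]_n) :=
  forall i, antideriv (fun x => F x i 0) (fun x => f x i 0).

Lemma antideriv_cv_cont n (F f : R -> 'cV[R]_n) : antideriv_cv F f -> cont_cv F.
Proof. by move=> dF i; apply: antideriv_continuous (dF i). Qed.

Lemma antideriv_dotcv n (F f G g : R -> 'cV[R]_n) :
  antideriv_cv F f -> antideriv_cv G g ->
  antideriv (fun x => dotcv (F x) (G x))
            (fun x => dotcv (f x) (G x) + dotcv (F x) (g x)).
Proof.
move=> dF dG; have -> : (fun x => dotcv (F x) (G x)) =
   (fun x => \sum_i F x i 0 * G x i 0) by apply/funext => x; rewrite dotcvE.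
have -> : (fun x => dotcv (f x) (G x) + dotcv (F x) (g x)) =
   (fun x => \sum_i (f x i 0 * G x i 0 + F x i 0 * g x i 0)).
  by apply/funext => x; rewrite !dotcvE -big_split.
by apply: antideriv_sum => i; apply: antideriv_mul.
Qed.

Lemma antideriv_mulmx n (W w : R -> 'M[R]_n) (F f : R -> 'cV[R]_n) :
  (forall i j, antideriv (fun x => W x i j) (fun x => w x i j)) ->
  antideriv_cv F f ->
  antideriv_cv (fun x => W x *m F x) (fun x => w x *m F x + W x *m f x).
Proof.
move=> dW dF i; have -> : (fun x => (W x *m F x) i 0) =
   (fun x => \sum_j W x i j * F x j 0) by apply/funext => x; rewrite mxE.
have -> : (fun x => (w x *m F x + W x *m f x) i 0) =
   (fun x => \sum_j (w x i j * F x j 0 + W x i j * f x j 0)).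
  by apply/funext => x; rewrite !mxE -big_split.
by apply: antideriv_sum => j; apply: antideriv_mul.
Qed.
End Calculus.

(** * The adjoint generator *)

Section Generator.
Context {R : realType} {m p : nat} (lambda : 'rV[R]_(m + p)).

Definition mulcv n (A : 'M[R]_n) (psi : R -> 'cV[R]_n) : R -> 'cV[R]_n :=
  fun x => A *m psi x.

Lemma cont_mulcv n (A : 'M[R]_n) psi : cont_cv psi -> cont_cv (mulcv A psi).
Proof.
by move=> cpsi; apply: (@cont_cv_mulmx _ _ (fun=> A)) => // i j; apply: cst_continuous.
Qed.

(** Outgoing is meant for [y]: components of negative speed leave the interval at 0, the others at
    1. The adjoint problem runs backwards in time, so its boundary condition prescribes the outgoing
    trace from the incoming one. *)
Definition out_trace (psi : R -> 'cV[R]_(m + p)) : 'cV[R]_(m + p) :=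
  col_mx (usubmx (psi 0)) (dsubmx (psi 1)).

Definition in_trace (psi : R -> 'cV[R]_(m + p)) : 'cV[R]_(m + p) :=
  col_mx (usubmx (psi 1)) (dsubmx (psi 0)).

(** The boolean, cast to 0 or 1, is the end point itself; this lets one formula treat both
    blocks. *)
Lemma out_trace_coord psi i : out_trace psi i 0 = psi (~~ (i < m)%N)%:R i 0.
Proof.
rewrite /out_trace; case: (splitP i) => j ij.
  have -> : i = lshift p j by apply: val_inj.
  by rewrite col_mxEu mxE.
have -> : i = rshift m j by apply: val_inj.
by rewrite col_mxEd mxE.
Qed.

Lemma in_trace_coord psi i : in_trace psi i 0 = psi (i < m)%N%:R i 0.
Proof.
rewrite /in_trace; case: (splitP i) => j ij.
  have -> : i = lshift p j by apply: val_inj.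
  by rewrite col_mxEu mxE.
have -> : i = rshift m j by apply: val_inj.
by rewrite col_mxEd mxE.
Qed.

Lemma out_traceB psi psi' : out_trace (psi - psi') = out_trace psi - out_trace psi'.
Proof. by apply/colP => i; rewrite subcvE !out_trace_coord; apply: subcvE. Qed.

Lemma in_traceB psi psi' : in_trace (psi - psi') = in_trace psi - in_trace psi'.
Proof. by apply/colP => i; rewrite subcvE !in_trace_coord; apply: subcvE. Qed.

(** The graph of the unbounded operator Lam d/dx, with the boundary condition as part of its domain.
    The bounded part [F^T + nu] is kept apart, so that the resolvent equation splits into scalar
    equations coupled at the boundary only. *)
Definition adj_gen (G : 'M[R]_(m + p)) (psi chi : R -> 'cV[R]_(m + p)) : Prop :=
  exists dpsi, [/\ antideriv_cv psi dpsi, cont_cv dpsi,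
    chi = mulcv (Lam lambda) dpsi &
    Lam_plus lambda *m out_trace psi = G^T *m Lam_plus lambda *m in_trace psi].

Lemma adj_gen_cont G psi chi : adj_gen G psi chi -> cont_cv psi /\ cont_cv chi.
Proof.
move=> [dpsi [d c -> _]]; split; first exact: antideriv_cv_cont d.
exact: cont_mulcv.
Qed.

Lemma antideriv_cvB n (F f F' f' : R -> 'cV[R]_n) : antideriv_cv F f ->
  antideriv_cv F' f' -> antideriv_cv (F - F') (f - f').
Proof.
move=> dF dF' i x.
have -> : (fun x => (F - F') x i 0) = (fun x => F x i 0) - (fun x => F' x i 0).
  by apply/funext => y; rewrite !mxE.
have -> : (f - f') x i 0 = f x i 0 - f' x i 0 by rewrite !mxE.
exact: is_deriveB (dF i x) (dF' i x).
Qed.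

Lemma adj_gen_B G psi chi psi' chi' : adj_gen G psi chi -> adj_gen G psi' chi' ->
  adj_gen G (psi - psi') (chi - chi').
Proof.
move=> [d [dd dc -> db]] [d' [dd' dc' -> db']]; exists (d - d'); split.
- exact: antideriv_cvB.
- exact: cont_cvB.
- by apply/funext => x; rewrite /mulcv mulmxBr.
- by rewrite out_traceB in_traceB !mulmxBr db db'.
Qed.

(* The decoupled equations psi_i - h lambda_i psi_i' = g_i are solved by variation of
   constants; the constants k are then fixed by the boundary condition. *)
Lemma adj_gen_solvable (G : 'M[R]_(m + p)) (h : R) g :
  (forall i, h * lambda 0 i != 0) -> cont_cv g ->
  (forall psi chi, adj_gen G psi chi -> psi - h *: chi = 0 ->
    Rintegral (@lebesgue_measure R) `]0, 1[ (fun x => dotcv (psi x) (psi x)) <= 0) ->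
  exists psi chi, adj_gen G psi chi /\ psi - h *: chi = g.
Proof.
move=> hl0 cg inj; pose a i := (h * lambda 0 i)^-1.
pose S (k : 'cV[R]_(m + p)) (x : R) : 'cV[R]_(m + p) :=
  \col_i (expR (a i * x) * k i 0).
pose r i x := expR (- a i * x) * (a i * g x i 0).
have cexp b : continuous (fun x : R => expR (b * x)).
  exact: antideriv_continuous (antideriv_expR b).
have cr i : continuous (r i).
  apply: cont_mul => //; apply: cont_mul; last exact: cg.
  exact: cst_continuous.
have [Phi dPhi] := choice (fun i => exists_antideriv (cr i)).
pose Pc x : 'cV[R]_(m + p) := \col_i Phi i x.
pose psi k x := S (k - Pc x) x.
pose dpsi k x : 'cV[R]_(m + p) := \col_i (a i * (psi k x i 0 - g x i 0)).
have dpsiP k : antideriv_cv (psi k) (dpsi k).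
  move=> i x.
  have -> : (fun x => psi k x i 0) =
      (fun x => expR (a i * x) * (k i 0 - Phi i x)).
    by apply/funext => y; rewrite !mxE.
  have := antideriv_mul (antideriv_expR (a i))
     (antideriv_add (antideriv_cst (k i 0)) (antideriv_scale (-1) (dPhi i))) x.
  have -> : (fun x => expR (a i * x) * (k i 0 + -1 * Phi i x)) =
      (fun x => expR (a i * x) * (k i 0 - Phi i x)).
    by apply/funext => y; rewrite mulN1r.
  move=> H; apply: is_derive_eq H _; rewrite !mxE /r.
  have : expR (a i * x) * expR (- a i * x) = 1 by rewrite -expRD mulNr subrr expR0.
  move: (expR (a i * x)) (expR (- a i * x)) => e e' ee.
  have -> : e * (0 + -1 * (e' * (a i * g x i 0))) = - (e * e') * (a i * g x i 0) by ring.
  by rewrite ee; ring.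
have cdpsi k : cont_cv (dpsi k).
  move=> i; have -> : (fun x => dpsi k x i 0) =
     (fun x => a i * (psi k x i 0 + -1 * g x i 0)).
    by apply/funext => y; rewrite [LHS]mxE mulN1r.
  apply: cont_mul; first exact: cst_continuous.
  apply: cont_add; first exact: (antideriv_cv_cont (dpsiP k)).
  by apply: cont_mul; [exact: cst_continuous|exact: cg].
have eqn k : psi k - h *: mulcv (Lam lambda) (dpsi k) = g.
  apply/funext => x; apply/colP => i.
  have -> : (psi k - h *: mulcv (Lam lambda) (dpsi k)) x i 0 =
      psi k x i 0 - h * (Lam lambda *m dpsi k x) i 0.
    by rewrite [LHS]subcvE; congr (_ - _); rewrite [LHS]mxE.
  rewrite /Lam mul_diag_mx [X in h * X]mxE [dpsi _ _ _ _]mxE !mulrA /a.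
  by rewrite mulfV ?hl0// mul1r subKr.
(* [M *m k] is the boundary defect of the homogeneous solution [S k], and [bd] below is that of the
   integral term subtracted from it; the boundary condition thus becomes the linear system
   [M *m k = bd]. *)
pose M : 'M[R]_(m + p) :=
  Lam_plus lambda *m diag_mx (\row_i expR (a i * (~~ (i < m)%N)%:R)) -
  G^T *m Lam_plus lambda *m diag_mx (\row_i expR (a i * (i < m)%N%:R)).
have SM k : Lam_plus lambda *m out_trace (S k) -
            G^T *m Lam_plus lambda *m in_trace (S k) = M *m k.
  have -> : out_trace (S k) =
      diag_mx (\row_i expR (a i * (~~ (i < m)%N)%:R)) *m k.
    by apply/colP => i; rewrite out_trace_coord mul_diag_mx !mxE.
  have -> : in_trace (S k) = diag_mx (\row_i expR (a i * (i < m)%N%:R)) *m k.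
    by apply/colP => i; rewrite in_trace_coord mul_diag_mx !mxE.
  by rewrite /M mulmxBl !mulmxA.
pose bd := Lam_plus lambda *m out_trace (fun x => S (Pc x) x) -
           G^T *m Lam_plus lambda *m in_trace (fun x => S (Pc x) x).
have bdP k : Lam_plus lambda *m out_trace (psi k) -
            G^T *m Lam_plus lambda *m in_trace (psi k) = M *m k - bd.
  have -> : psi k = S k - (fun x => S (Pc x) x).
    apply/funext => x; apply/colP => i; rewrite [RHS]subcvE !mxE.
    by rewrite mulrBr.
  by rewrite out_traceB in_traceB !mulmxBr -SM /bd !opprB addrACA [RHS]addrACA;
    congr (_ + _); rewrite addrC.
pose dS k x : 'cV[R]_(m + p) := \col_i (a i * S k x i 0).
have dSP k : antideriv_cv (S k) (dS k).
  move=> i x; have -> : (fun x => S k x i 0) = (fun x => k i 0 * expR (a i * x)).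
    by apply/funext => y; rewrite mxE mulrC.
  apply: is_derive_eq (antideriv_scale (k i 0) (antideriv_expR (a i)) x) _.
  by rewrite !mxE; ring.
have cdS k : cont_cv (dS k).
  move=> i; have -> : (fun x => dS k x i 0) = (fun x => a i * S k x i 0).
    by apply/funext => y; rewrite [LHS]mxE.
  apply: cont_mul; first exact: cst_continuous.
  exact: (antideriv_cv_cont (dSP k)).
have eqn0 k : S k - h *: mulcv (Lam lambda) (dS k) = 0.
  apply/funext => x; apply/colP => i; rewrite [LHS]subcvE [RHS]mxE.
  have -> : (h *: mulcv (Lam lambda) (dS k)) x i 0 = h * (Lam lambda *m dS k x) i 0.
    by rewrite [LHS]mxE.
  rewrite /Lam mul_diag_mx [X in h * X]mxE [dS _ _ _ _]mxE !mulrA /a.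
  by rewrite mulfV ?hl0// mul1r subrr.
(* Fredholm alternative in finite dimension: a kernel vector yields a homogeneous solution
   satisfying the boundary condition, which has zero L^2 norm by [inj]. On the unit interval its
   [i]-th component is at least exp(-|a_i|) times the [i]-th entry of the vector in absolute value,
   so the vector vanishes. *)
have uM : M \in unitmx.
  rewrite -unitmx_tr -row_free_unit; apply/inj_row_free => v vM.
  have {vM} Mk : M *m v^T = 0 by rewrite -(trmxK M) -trmx_mul vM trmx0.
  apply/eqP; apply: contraT => /eqP v0; exfalso; apply: v0.
  have gk : adj_gen G (S v^T) (mulcv (Lam lambda) (dS v^T)).
    exists (dS v^T); split => //; apply/eqP; rewrite -subr_eq0 SM Mk//.
  have cS : cont_cv (S v^T) := antideriv_cv_cont (dSP _).
  have := inj _ _ gk (eqn0 _) => I0.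
  apply/rowP => i; rewrite [RHS]mxE; apply/eqP; rewrite -sqrf_eq0 eq_le sqr_ge0 andbT.
  have e0 : 0 < expR (- `|a i|) ^+ 2 by rewrite exprn_gt0// expR_gt0.
  rewrite -(pmulr_rle0 _ e0) -[leLHS]Rintegral01_cst; apply: le_trans I0.
  apply: le_Rintegral => //.
  - by apply: continuous_integrable01; apply: cst_continuous.
  - by apply: continuous_integrable01; apply: cont_dotcv.
  - move=> x /=; rewrite in_itv/= => /andP[/ltW x0 /ltW x1].
    rewrite dotcvE (bigD1 i)//= ler_wpDr//.
      by apply: sumr_ge0 => j _; rewrite -expr2 sqr_ge0.
    rewrite !mxE -expr2 exprMn ler_wpM2r ?sqr_ge0//.
    rewrite ler_sqr ?nnegrE ?expR_ge0// ler_expR.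
    have := ler_norm (- (a i * x)); rewrite normrN normrM (ger0_norm x0).
    by have := ler_wpM2l (normr_ge0 (a i)) x1; lra.
exists (psi (invmx M *m bd)), (mulcv (Lam lambda) (dpsi (invmx M *m bd))).
split; last exact: eqn.
exists (dpsi (invmx M *m bd)); split => //.
by apply/eqP; rewrite -subr_eq0 bdP mulmxA mulmxV// mul1mx subrr.
Qed.
End Generator.

(** * Density of C^1 functions vanishing at the end points *)

Section Density.
Context {R : realType}.
Notation mu := (@lebesgue_measure R).
Implicit Types f g : R -> R^o.

(** Values in [R^o] make the scalar functions an [lmodType], as [semi_inner] requires. *)
Definition sqint01 f : Prop := measurable_fun (`]0, 1[%classic : set R) (f : R -> R) /\
  mu.-integrable `]0, 1[ (EFin \o (fun x => (f x : R) ^+ 2)).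

Definition sdot f g : R := \int[mu]_(x in `]0, 1[) ((f x : R) * g x).

Lemma sqint01_mul f g : sqint01 f -> sqint01 g ->
  mu.-integrable `]0, 1[ (EFin \o (fun x => (f x : R) * g x)).
Proof. by move=> [mf f2] [mg g2]; apply: integrable_mul_sqr. Qed.

Lemma sqint01_lin (a : R) f g : sqint01 f -> sqint01 g -> sqint01 (a *: f + g).
Proof.
move=> [mf f2] [mg g2].
have m1 : measurable_fun (`]0, 1[%classic : set R) (fun x => a * (f x : R) + g x).
  by apply: measurable_funD => //; apply: measurable_funM.
split=> //; apply: le_integrable01 (integrable01D (integrable01Z (2 * a ^+ 2) f2)
  (integrable01Z 2 g2)); first exact: measurable_funX.
move=> x /=; rewrite ger0_norm ?sqr_ge0//.
have -> : (a *: f + g) x = a * f x + g x :> R by [].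
by have := sqr_ge0 (a * f x - g x : R); nra.
Qed.

Lemma continuous_sqint01 f : continuous (f : R -> R) -> sqint01 f.
Proof.
move=> cf; split; first exact: continuous_measurable01.
by apply: continuous_integrable01; exact: cont_mul.
Qed.

Lemma semi_inner_sdot : semi_inner sqint01 sdot.
Proof.
split.
- exact: sqint01_lin.
- by apply: continuous_sqint01; exact: (@cst_continuous R R 0).
- by move=> f g _ _; apply: eq_Rintegral => x _; rewrite mulrC.
- move=> a f g h Sf Sg Sh.
  have -> : sdot (a *: f + g) h =
      \int[mu]_(x in `]0, 1[) (a * ((f x : R) * h x) + (g x : R) * h x).
    by apply: eq_Rintegral => x _; rewrite mulrA -mulrDl.
  have I1 := sqint01_mul Sf Sh; have I2 := sqint01_mul Sg Sh.
  by rewrite RintegralD//; [rewrite RintegralZl|apply: integrable01Z].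
- by move=> f _; apply: Rintegral_ge0 => x _; rewrite -expr2 sqr_ge0.
Qed.

Lemma dominated_L2 (g_ : nat -> R -> R) (g H : R -> R) :
  (forall n, measurable_fun (`]0, 1[%classic : set R) (g_ n)) ->
  measurable_fun (`]0, 1[%classic : set R) g ->
  mu.-integrable `]0, 1[ (EFin \o H) ->
  (forall n x, 0 < x < 1 -> (g x - g_ n x) ^+ 2 <= H x) ->
  (forall x, 0 < x < 1 -> g_ n x @[n --> \oo] --> g x) ->
  forall e, 0 < e -> exists n, sdot (fun x => g x - g_ n x) (fun x => g x - g_ n x) <= e.
Proof.
move=> mg_ mg iH gH gg e e0.
pose h n x := ((g x - g_ n x) ^+ 2)%:E.
have mh n : measurable_fun (`]0, 1[%classic : set R) (h n).
  by apply/measurable_EFinP; apply: measurable_funX; apply: measurable_funB.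
have m0 : measurable_fun (`]0, 1[%classic : set R) (fun=> 0%E : \bar R).
  exact: measurable_cst.
have hcv x : (`]0, 1[%classic : set R) x -> h^~ x @ \oo --> (0%E : \bar R).
  rewrite /= in_itv/= => x01; apply: cvg_EFin; first by near=> n.
  have : (g x - g_ n x) * (g x - g_ n x) @[n --> \oo] --> (g x - g x) * (g x - g x).
    by apply: cvgM; (apply: cvgB; [exact: cvg_cst|exact: gg]).
  by rewrite subrr mulr0.
have hH x n : (`]0, 1[%classic : set R) x -> (`|h n x| <= (EFin \o H) x)%E.
  by rewrite /= in_itv/= => x01; rewrite lee_fin ger0_norm ?sqr_ge0// gH.
have [|||||_ _] := @dominated_convergence _ _ _ mu `]0, 1[%classic (measurable_itv _)
    h (cst 0%E) (EFin \o H) => //; [exact: aeW|exact: aeW|].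
rewrite integral0 => /fine_cvgP[_] /cvgrPdist_le/(_ _ e0)[n _ /(_ n (leqnn n))].
rewrite sub0r normrN => le_e; exists n; apply: le_trans (ler_norm _) _.
apply: le_trans le_e; rewrite /sdot /Rintegral le_eqVlt; apply/orP; left; apply/eqP.
by congr (`|fine _|); apply: eq_integral => x _; rewrite /h expr2.
Unshelve. all: by end_near. Qed.

Section Closure.
Variables (f : R -> R) (C : R).
Hypothesis f_sq : sqint01 f.

Definition pairing_le g : Prop := sdot g f <= C * snorm sdot g.

(** Both sides of the inequality are continuous in the L^2 norm: passing from [v] to [g] costs at
    most [C + snorm sdot f] times the distance, and [K] is this factor made positive. *)
Lemma pairing_le_closed g : sqint01 g -> 0 <= C ->
  (forall e, 0 < e -> exists v, [/\ sqint01 v, pairing_le v & sdot (g - v) (g - v) <= e]) ->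
  pairing_le g.
Proof.
move=> gs C0 app; rewrite /pairing_le; apply/ler_addgt0Pr => e e0.
pose K := C + snorm sdot f + 1.
have K0 : 0 < K by rewrite ltr_wpDl// addr_ge0// semi_inner_norm_ge0.
have [v [vs tv gv]] := app _ (exprn_gt0 2 (divr_gt0 e0 K0)).
have ds : sqint01 (g - v) by apply: (semi_innerB_closed semi_inner_sdot).
have nd : snorm sdot (g - v) <= e / K.
  rewrite -(ger0_norm (ltW (divr_gt0 e0 K0))) -sqrtr_sqr.
  by apply: ler_wsqrtr.
have E : sdot g f = sdot v f + sdot (g - v) f.
  by rewrite -(semi_innerDl semi_inner_sdot)// addrC subrK.
have h1 := semi_inner_CS semi_inner_sdot ds f_sq.
have h2 : snorm sdot v <= snorm sdot g + snorm sdot (g - v).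
  rewrite -{1}[v](subKr g); exact: (semi_inner_normB semi_inner_sdot).
have h3 := ler_wpM2l C0 h2.
have h4 : (C + snorm sdot f) * snorm sdot (g - v) <= e.
  apply: (@le_trans _ _ (K * (e / K))); last by rewrite mulrC divfK ?gt_eqF.
  apply: ler_pM => //; rewrite ?semi_inner_norm_ge0 ?addr_ge0 ?semi_inner_norm_ge0//.
  by rewrite /K lerDl.
rewrite /pairing_le in tv; rewrite E; lra.
Qed.

Definition C1_fun (g : R -> R) : Prop := exists2 dg, antideriv g dg & continuous dg.

Lemma C1_continuous (g : R -> R) : C1_fun g -> continuous g.
Proof. by move=> [dg /antideriv_continuous]. Qed.

Lemma C1_cst (a : R) : C1_fun (fun=> a).
Proof. by exists (fun=> 0); [exact: antideriv_cst|exact: cst_continuous]. Qed.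

Lemma C1_id : C1_fun id.
Proof. by exists (fun=> 1); [move=> x; exact: is_derive_id|exact: cst_continuous]. Qed.

Lemma C1_add (g1 g2 : R -> R) : C1_fun g1 -> C1_fun g2 -> C1_fun (fun x => g1 x + g2 x).
Proof.
move=> [d1 a1 c1] [d2 a2 c2]; exists (fun x => d1 x + d2 x).
  exact: antideriv_add.
exact: cont_add.
Qed.

Lemma C1_mul (g1 g2 : R -> R) : C1_fun g1 -> C1_fun g2 -> C1_fun (fun x => g1 x * g2 x).
Proof.
move=> h1 h2; have [c1 c2] := (C1_continuous h1, C1_continuous h2).
case: h1 h2 => [d1 a1 e1] [d2 a2 e2].
exists (fun x => d1 x * g2 x + g1 x * d2 x); first exact: antideriv_mul.
by apply: cont_add; apply: cont_mul.
Qed.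

Lemma C1_exp (g : R -> R) n : C1_fun g -> C1_fun (fun x => g x ^+ n).
Proof.
move=> cg; elim: n => [|n IH].
  have -> : (fun x => g x ^+ 0) = (fun=> 1) by apply/funext => x; rewrite expr0.
  exact: C1_cst.
have -> : (fun x => g x ^+ n.+1) = (fun x => g x * g x ^+ n).
  by apply/funext => x; rewrite exprS.
exact: C1_mul.
Qed.

Lemma continuous_bounded (g : R -> R) (a b : R) : a <= b -> continuous g ->
  exists2 B, 0 <= B & forall x, a <= x <= b -> `|g x| <= B.
Proof.
move=> ab cg; have cn : {within `[a, b], continuous (fun x => `|g x|)}.
  by apply: continuous_subspaceT => x; apply: cvg_norm; exact: cg.
have [c _ cmax] := EVT_max ab cn; by exists `|g c|.
Qed.

Hypothesis C_ge0 : 0 <= C.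
Hypothesis pairing_le_C10 : forall g, C1_fun g -> g 0 = 0 -> g 1 = 0 -> pairing_le g.

(* Cut-off at the end points by the polynomials 1 - (2x-1)^(2n). *)
Lemma pairing_le_C1 g : C1_fun g -> pairing_le g.
Proof.
move=> cg; have cgc := C1_continuous cg.
pose c n (x : R) := 1 + -1 * ((-1 + 2 * x) ^+ 2) ^+ n.
have C1c n : C1_fun (c n).
  apply: C1_add; first exact: C1_cst.
  apply: C1_mul; first exact: C1_cst.
  apply: C1_exp; apply: C1_exp; apply: C1_add; first exact: C1_cst.
  by apply: C1_mul; [exact: C1_cst|exact: C1_id].
have cc n := C1_continuous (C1c n).
have [B B0 gB] := continuous_bounded (@ler01 R) cgc.
have b01 (x : R) : 0 < x < 1 -> 0 <= (-1 + 2 * x) ^+ 2 < 1.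
  by move=> /andP[x0 x1]; rewrite sqr_ge0/=; nra.
apply: pairing_le_closed => //; first exact: continuous_sqint01.
move=> e e0.
have [] := @dominated_L2 (fun n x => c n.+1 x * g x) g (fun=> B ^+ 2) _ _ _ _ _ e e0.
- by move=> n; apply: continuous_measurable01; apply: cont_mul.
- exact: continuous_measurable01.
- by apply: continuous_integrable01; apply: cst_continuous.
- move=> n x x01; have -> : g x - c n.+1 x * g x = ((-1 + 2 * x) ^+ 2) ^+ n.+1 * g x.
    by rewrite /c; ring.
  have /andP[b0 b1] := b01 x x01.
  rewrite exprMn -[leRHS]mul1r; apply: ler_pM; rewrite ?sqr_ge0//.
    by apply: exprn_ile1; [exact: exprn_ge0|apply: exprn_ile1 => //; exact: ltW].
  rewrite -(real_normK (num_real (g x))) ler_sqr ?nnegrE//.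
  by apply: gB; case/andP: x01 => /ltW -> /ltW ->.
- move=> x x01; have /andP[b0 b1] := b01 x x01.
  rewrite -[X in _ --> X]mul1r; apply: cvgM; last exact: cvg_cst.
  rewrite -[X in _ --> X]addr0; apply: cvgD; first exact: cvg_cst.
  rewrite -[X in _ --> X](mulr0 (-1)); apply: cvgM; first exact: cvg_cst.
  by rewrite cvg_shiftS; apply: cvg_expr; rewrite ger0_norm.
move=> n He; exists (fun x => c n.+1 x * g x); split=> //.
  by apply: continuous_sqint01; apply: cont_mul.
have z1 : (-1 + 2 * 0 : R) ^+ 2 = 1 by ring.
have z2 : (-1 + 2 * 1 : R) ^+ 2 = 1 by ring.
apply: pairing_le_C10; first exact: C1_mul.
  by rewrite /c z1 expr1n; ring.
by rewrite /c z2 expr1n; ring.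
Qed.

(** [u n x] is the mean of [g] over an interval of length 1/(n+1) to the right of [x], written with
    an antiderivative [F] and therefore C^1. The mean value theorem makes it a value of [g] nearby,
    which gives both the uniform bound and the pointwise limit. *)
Lemma pairing_le_continuous (g : R -> R) : continuous g -> pairing_le g.
Proof.
move=> cg; have [F dF] := exists_antideriv cg.
have cF := antideriv_continuous dF.
pose u n x := n.+1%:R * (F (x + n.+1%:R^-1) + -1 * F x).
have C1u n : C1_fun (u n).
  apply: C1_mul; first exact: C1_cst.
  apply: C1_add; last first.
    by apply: C1_mul; [exact: C1_cst|exists g].
  exists (fun x => g (x + n.+1%:R^-1)).
    move=> x; have := @is_derive1_comp _ F (fun x => x + n.+1%:R^-1) x _ _
      (dF (x + n.+1%:R^-1)) (antideriv_add (fun y => is_derive_id y 1) (antideriv_cst n.+1%:R^-1) x).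
    by rewrite addr0 mulr1.
  apply: cont_comp => //.
  by apply: cont_add; [move=> y; exact: cvg_id|exact: cst_continuous].
have i0 n : 0 < n.+1%:R^-1 :> R by rewrite invr_gt0 ltr0n.
have i1 n : n.+1%:R^-1 <= 1 :> R by rewrite invf_le1 ?ltr0n// ler1n.
have mean n x : exists2 z, x < z < x + n.+1%:R^-1 & u n x = g z.
  have xx : x < x + n.+1%:R^-1 by rewrite ltrDl.
  have [z zx E] := MVT xx (fun y _ => dF y) (continuous_subspaceT cF).
  exists z; first by move: zx; rewrite in_itv.
  rewrite /u mulN1r E addrAC subrr add0r [g z * _]mulrC mulrA mulfV ?mul1r//.
(* The bound is taken on [[0, 2]] because the means look up to one unit beyond [x]. *)
have [B B0 gB] := continuous_bounded (ler0n R 2) cg.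
have uB n x : 0 < x < 1 -> `|u n x| <= B.
  move=> /andP[x0 x1]; have [z /andP[xz zx] ->] := mean n x.
  by apply: gB; rewrite (ltW (lt_trans x0 xz))/=;
    move: (n.+1%:R^-1) (i1 n) zx => w w1 zx; lra.
apply: pairing_le_closed => //; first exact: continuous_sqint01.
move=> e e0.
have [] := @dominated_L2 u g (fun=> (2 * B) ^+ 2) _ _ _ _ _ e e0.
- by move=> n; apply: continuous_measurable01; exact: C1_continuous.
- exact: continuous_measurable01.
- by apply: continuous_integrable01; apply: cst_continuous.
- move=> n x x01; rewrite -(real_normK (num_real (g x - _))) ler_sqr ?nnegrE ?mulr_ge0//.
  apply: le_trans (ler_normB _ _) _; have := uB n x x01.
  have : `|g x| <= B by apply: gB; case/andP: x01 => x0 x1; rewrite ltW//=; lra.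
  by lra.
- move=> x x01; apply/cvgrPdist_lt => d d0.
  have /cvgrPdist_lt/(_ d d0) := cg x; rewrite near_simpl => -[r /= r0 gr].
  near=> n; have [z /andP[xz zx] ->] := mean n x.
  apply: gr => /=; rewrite distrC ger0_norm; last by rewrite subr_ge0 ltW.
  have : n.+1%:R^-1 < r by near: n; exact: near_infty_natSinv_lt (PosNum r0).
  by move: (n.+1%:R^-1) zx => w zx wr; lra.
move=> n He; exists (u n); split=> //.
  by apply: continuous_sqint01; exact: C1_continuous.
exact: pairing_le_C1.
Unshelve. all: by end_near. Qed.

Definition clip (N x : R) : R := Num.max (- N) (Num.min N x).

Lemma clip_bound N x : 0 <= N -> `|clip N x| <= N.
Proof.
move=> N0; rewrite ler_norml /clip le_max lexx/= ge_max ge_min lexx andbT.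
lra.
Qed.

Lemma clip_id N x : `|x| <= N -> clip N x = x.
Proof.
by rewrite ler_norml => /andP[h1 h2]; rewrite /clip min_r// max_r.
Qed.

(** Truncation is the projection onto [[-N, N]], which contains [x]. *)
Lemma clip_dist N x y : `|x| <= N -> `|x - clip N y| <= `|x - y|.
Proof.
rewrite ler_norml => /andP[h1 h2]; rewrite /clip /Num.max /Num.min.
have [h3|h3] := ltP N y; case: ltP => h4; rewrite ler_norml;
  have := ler_norm (x - y); have := ler_norm (y - x);
  rewrite [`|y - x|]distrC => h5 h6; apply/andP; split; lra.
Qed.

Lemma clip_continuous N (u : R -> R) : continuous u -> continuous (fun x => clip N (u x)).
Proof.
move=> cu x; apply: (@continuous_max _ _ (fun=> - N) (fun x => Num.min N (u x))).
  exact: cst_continuous.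
by apply: (@continuous_min _ _ (fun=> N) u); [exact: cst_continuous|exact: cu].
Qed.

Lemma clip_measurable N (u : R -> R) : measurable_fun (`]0, 1[%classic : set R) u ->
  measurable_fun (`]0, 1[%classic : set R) (fun x => clip N (u x)).
Proof.
by move=> mu'; apply: measurable_maxr => //; apply: measurable_minr.
Qed.

Lemma bounded_sqint01 (N : R) (g : R -> R) : measurable_fun (`]0, 1[%classic : set R) g ->
  (forall x, `|g x| <= N) -> sqint01 g.
Proof.
move=> mg gN; split=> //.
apply: (le_integrable01 (g := fun=> N ^+ 2)); first exact: measurable_funX.
  move=> x; rewrite ger0_norm ?sqr_ge0// -(real_normK (num_real (g x))).
  by rewrite ler_sqr ?nnegrE// (le_trans (normr_ge0 _) (gN x)).
by apply: continuous_integrable01; apply: cst_continuous.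
Qed.

(** Continuous functions approximate [g] in L^1. Truncating them at [N] moves them no farther from
    [g] and bounds the difference by 2N, so its square is at most 2N times the L^1 integrand: the
    approximation holds in L^2. *)
Lemma pairing_le_bounded (N : R) (g : R -> R) : measurable_fun (`]0, 1[%classic : set R) g ->
  (forall x, `|g x| <= N) -> pairing_le g.
Proof.
move=> mg gN; have gs := bounded_sqint01 mg gN.
have N0 : 0 <= N := le_trans (normr_ge0 _) (gN 0).
have ig : mu.-integrable `]0, 1[ (EFin \o g).
  apply: (le_integrable01 (g := fun=> N)) => //.
  by apply: continuous_integrable01; apply: cst_continuous.
have fin01 : (mu `]0%R, 1%R[%classic < +oo)%E.
  by have := lebesgue_measure_itv `]0%R, 1%R[ => /= ->; rewrite lte_fin ltr01 ltry.
have [u [cu iu u0]] := approximation_continuous_integrable (measurable_itv _) fin01 ig.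
apply: pairing_le_closed => // e e0.
have e1 : 0 < e / (2 * N + 1) by rewrite divr_gt0// ltr_wpDl// mulr_ge0.
move/fine_cvgP: u0 => [_] /cvgrPdist_le/(_ _ e1)[n _ /(_ n (leqnn n))].
rewrite sub0r normrN => Hn.
have cv := @clip_continuous N _ (cu n).
have vN x : `|clip N (u n x)| <= N by exact: clip_bound.
exists (fun x => clip N (u n x)); split; [exact: continuous_sqint01| |].
  exact: pairing_le_continuous.
have iau : mu.-integrable `]0, 1[ (EFin \o (fun x => `|g x - u n x|)).
  apply: (le_integrable01 (g := fun x => `|g x| + `|u n x|)).
  - apply: measurableT_comp => //; apply: measurable_funB => //.
    exact: continuous_measurable01.
  - by move=> x; rewrite normr_id; exact: ler_normB.
  - apply: integrable01D; last first.
      by apply: continuous_integrable01 => x; apply: cvg_norm; exact: cu.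
    apply: (le_integrable01 (g := fun=> N)); first exact: measurableT_comp.
      by move=> x; rewrite normr_id.
    by apply: continuous_integrable01; apply: cst_continuous.
have vs := continuous_sqint01 cv.
have ds := semi_innerB_closed semi_inner_sdot gs vs.
apply: (@le_trans _ _ (\int[mu]_(x in `]0, 1[) (2 * N * `|g x - u n x|))).
  apply: le_Rintegral => //; [exact: sqint01_mul|exact: integrable01Z|].
  move=> x _; rewrite -expr2 -(real_normK (num_real _)) expr2.
  have h1 : `|g x - clip N (u n x)| <= 2 * N.
    by apply: le_trans (ler_normB _ _) _; have := gN x; have := vN x; lra.
  by apply: ler_pM => //; exact: clip_dist.
rewrite RintegralZl//; move: Hn; rewrite ger0_norm; last first.
  by apply: fine_ge0; apply: integral_ge0 => x _.
move=> Hn; apply: (@le_trans _ _ (2 * N * (e / (2 * N + 1)))).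
  by rewrite ler_wpM2l ?mulr_ge0.
rewrite mulrCA ler_piMr ?(ltW e0)// ler_pdivrMr ?mul1r ?lerDl//.
by rewrite ltr_wpDl// mulr_ge0.
Qed.

(** The inequality is available for bounded functions only, so [f] is tested against its own
    truncation [v]. Since [v^2 <= v f] pointwise, the square of the norm of [v] is at most [C] times
    that norm; the truncation level then tends to infinity. *)
Lemma snorm_le_of_C1_pairing : snorm sdot f <= C.
Proof.
have mf := f_sq.1.
have mc N := @clip_measurable N _ mf.
have cb (N : nat) x : `|clip N%:R (f x)| <= N%:R :> R by exact: clip_bound.
have cs (N : nat) : sqint01 (fun x => clip N%:R (f x)).
  exact: bounded_sqint01 (cb N).
have step (N : nat) : snorm sdot (fun x => clip N%:R (f x)) <= C.
  have := pairing_le_bounded (mc N%:R) (cb N); rewrite /pairing_le.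
  set v := (fun x => clip _ _) => tv.
  have vv : sdot v v <= sdot v f.
    apply: le_Rintegral => //; [exact: sqint01_mul (cs N) (cs N)|exact: sqint01_mul (cs N) f_sq|].
    move=> x _; rewrite /v /clip /Num.max /Num.min.
    have N0 : 0 <= N%:R :> R by [].
    rewrite -subr_ge0 -mulrBr; have [h1|h1] := ltP N%:R (f x); case: ltP => h2;
    by first [rewrite subrr mulr0|apply: mulr_ge0; lra|apply: mulr_le0; lra].
  have := le_trans vv tv; rewrite -(semi_inner_sqr semi_inner_sdot (cs N)) expr2.
  have : 0 <= snorm sdot v by exact: semi_inner_norm_ge0.
  rewrite le_eqVlt => /predU1P[<-//|v0]; by rewrite ler_pM2r.
apply/ler_addgt0Pr => e e0.
have [] := @dominated_L2 (fun N x => clip N%:R (f x)) f (fun x => f x ^+ 2) _ _ _ _ _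
  (e ^+ 2) (exprn_gt0 2 e0).
- by move=> N; exact: mc.
- exact: mf.
- exact: f_sq.2.
- move=> N x _; rewrite -(real_normK (num_real (f x - _))) -(real_normK (num_real (f x))).
  rewrite ler_sqr ?nnegrE// /clip /Num.max /Num.min.
  have N0 : 0 <= N%:R :> R by [].
  have [h1|h1] := ltP N%:R (f x); case: ltP => h2; rewrite ler_norml;
  have := ler_norm (f x); have := ler_norm (- f x); rewrite normrN => h5 h6;
  apply/andP; split; lra.
- move=> x _; apply: cvg_near_cst; near=> N; apply: clip_id.
  apply: ltW; apply: lt_le_trans (Num.Theory.truncnS_gt _) _.
  by rewrite ler_nat; near: N; exact: nbhs_infty_ge.
move=> N HN.
have nd : snorm sdot (f - (fun x => clip N%:R (f x))) <= e.
  by rewrite -(ger0_norm (ltW e0)) -sqrtr_sqr; apply: ler_wsqrtr.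
have -> : f = (fun x => clip N%:R (f x)) + (f - (fun x => clip N%:R (f x))) :> (R -> R^o).
  by rewrite addrC subrK.
apply: le_trans (semi_inner_normD semi_inner_sdot (cs N) _) _.
  exact: (semi_innerB_closed semi_inner_sdot).
exact: lerD.
Unshelve. all: by end_near. Qed.

End Closure.
End Density.

(** * Weak solutions tested against the adjoint generator *)

Section Trajectory.
Context {R : realType} {n : nat}.
Implicit Types z : R -> R -> 'cV[R]_n.
Local Notation N := (snorm (@L2dot R n)).

Lemma C0_L2_at z t e : C0_L2 z -> 0 <= t -> 0 < e ->
  exists2 d, 0 < d & forall s, 0 <= s -> `|t - s| < d -> N (z s - z t) < e.
Proof.
move=> [_ cz] t0 e0; have /cvgrPdist_lt/(_ e e0) := cz t t0.
move=> /nbhs_ballP[d /= d0 dP]; exists d => // s s0 ts.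
have := dP s ts s0; rewrite sub0r normrN; apply: le_lt_trans.
exact: ler_norm.
Qed.

Lemma L2norm_dist f g : L2_01 f -> L2_01 g -> `|N f - N g| <= N (f - g).
Proof.
move=> Lf Lg; have Lfg := semi_innerB_closed semi_inner_L2 Lf Lg.
rewrite ler_norml; apply/andP; split.
  have := semi_inner_normB semi_inner_L2 Lf Lfg; rewrite subKr; lra.
have := semi_inner_normD semi_inner_L2 Lfg Lg; rewrite subrK; lra.
Qed.

Lemma C0_L2_bounded z T : C0_L2 z -> 0 <= T ->
  exists2 K, 0 <= K & forall t, 0 <= t <= T -> N (z t) <= K.
Proof.
move=> cz T0; have [Lz _] := cz.
(* The even extension makes the norm continuous on the whole line, although [z] is only controlled
   for nonnegative times. *)
have cN : continuous (fun t : R => N (z `|t|)).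
  move=> t; apply/cvgrPdist_lt => e e0.
  have [d d0 dP] := C0_L2_at cz (normr_ge0 t) e0.
  apply/nbhs_ballP; exists d => //= s ts; rewrite distrC.
  apply: le_lt_trans (L2norm_dist (Lz _ (normr_ge0 _)) (Lz _ (normr_ge0 _))) _.
  apply: dP => //; apply: le_lt_trans ts.
  by have := ler_dist_dist t s.
have [K K0 bK] := continuous_bounded T0 cN; exists K => // t tT.
have := bK t tT; rewrite (ger0_norm (proj1 (andP tT))).
exact: le_trans (ler_norm _).
Qed.

(** Heine-Cantor for a trajectory measured by a seminorm: compactness of [[0, T]], in its
    near-covering form, yields a common radius. Half radii leave room for the triangle inequality
    around the centre. *)
Lemma C0_L2_uniform z T e : C0_L2 z -> 0 < e ->
  exists2 d, 0 < d & forall s t, 0 <= s <= T -> 0 <= t <= T -> `|t - s| < d ->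
    N (z s - z t) < e.
Proof.
move=> cz e0; have [Lz _] := cz.
have e2 : 0 < e / 2 by rewrite divr_gt0.
pose Q (d t : R) := forall s, 0 <= s <= T -> 0 <= t <= T -> `|t - s| < d -> N (z s - z t) < e.
have cov := proj1 (compact_near_coveringP _) (@segment_compact R 0 T).
have [t|d /= d0 dP] := cov R (0^'+) Q _.
  rewrite /= in_itv/= => /andP[t0 tT].
  have [d d0 dP] := C0_L2_at cz t0 e2.
  have d2 : 0 < d / 2 by rewrite divr_gt0.
  near=> t' r => s /= sT t'T ts.
  have s0 : 0 <= s by case/andP: sT.
  have t'0 : 0 <= t' by case/andP: t'T.
  have tt' : `|t - t'| < d / 2 by near: t'; exact: (nbhsx_ballx t _ d2).
  have rd : r < d / 2 by near: r; exact: nbhs_right_lt.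
  have ts' : `|t - s| < d by have := ler_distD t' t s; lra.
  have tt2 : `|t - t'| < d by lra.
  have h1 := dP t' t'0 tt2; have h2 := dP s s0 ts'.
  have Ls := Lz s s0; have Lt := Lz t t0; have Lt' := Lz t' t'0.
  have := semi_inner_normB semi_inner_L2 (semi_innerB_closed semi_inner_L2 Ls Lt)
    (semi_innerB_closed semi_inner_L2 Lt' Lt).
  by rewrite opprB addrA subrK; lra.
exists (d / 2); first by rewrite divr_gt0.
move=> s t sT tT ts; apply: (dP (d / 2) _ _ t _ s sT tT ts).
- by rewrite /ball_ /= sub0r normrN gtr0_norm ?divr_gt0//; lra.
- by rewrite divr_gt0.
- by rewrite /= in_itv.
Unshelve. all: by end_near. Qed.

Lemma C0_L2_scale z nu : C0_L2 z -> C0_L2 (fun t => expR (nu * t) *: z t).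
Proof.
move=> cz; have [Lz cvz] := cz; split.
  by move=> t t0; apply: (semi_innerZ_closed semi_inner_L2); exact: Lz.
move=> t t0; set FF := within _ _.
pose b s := expR (nu * s) * N (z s - z t) + `|expR (nu * s) - expR (nu * t)| * N (z t).
have ce : continuous (fun s : R => expR (nu * s)) := antideriv_continuous (antideriv_expR nu).
have ce' : expR (nu * s) @[s --> FF] --> expR (nu * t).
  by apply: cvg_within_filter; exact: ce.
have cb : b s @[s --> FF] --> (0 : R).
  have -> : (0 : R) = expR (nu * t) * 0 + `|expR (nu * t) - expR (nu * t)| * N (z t).
    by rewrite mulr0 subrr normr0 mul0r addr0.
  apply: cvgD; first by apply: cvgM => //; exact: cvz.
  apply: cvgM; last exact: cvg_cst.
  by apply: cvg_norm; apply: cvgB => //; exact: cvg_cst.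
apply: (squeeze_cvgr _ (cvg_cst 0) cb); rewrite near_withinE; near=> s => /= s0.
have Ls := Lz s s0; have Lt := Lz t t0.
apply/andP; split; first exact: sqrtr_ge0.
have -> : (fun x => (expR (nu * s) *: z s) x - (expR (nu * t) *: z t) x) =
   expR (nu * s) *: (z s - z t) + (expR (nu * s) - expR (nu * t)) *: z t.
  by rewrite scalerBr scalerBl addrA subrK.
apply: le_trans (semi_inner_normD semi_inner_L2 _ _) _.
- by apply: (semi_innerZ_closed semi_inner_L2); exact: (semi_innerB_closed semi_inner_L2).
- exact: (semi_innerZ_closed semi_inner_L2).
rewrite !(semi_inner_normZ semi_inner_L2)//; last exact: (semi_innerB_closed semi_inner_L2).
by rewrite (ger0_norm (expR_ge0 _)).
Unshelve. all: by end_near. Qed.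
End Trajectory.

Section Weak.
Context {R : realType}.
Notation leb := (@lebesgue_measure R).

Lemma L2norm_ae0 n (f g : R -> 'cV[R]_n) : L2_01 f -> L2_01 g ->
  {ae leb, forall x, 0 < x < 1 -> f x = g x} -> snorm (@L2dot R n) (f - g) = 0.
Proof.
move=> Lf Lg fg; rewrite /snorm; apply/eqP; rewrite sqrtr_eq0.
have Lfg := semi_innerB_closed semi_inner_L2 Lf Lg.
have I := integrable_dotcv Lfg Lfg.
rewrite /L2dot /Rintegral.
have -> : (\int[leb]_(x in `]0%R, 1%R[) (dotcv ((f - g) x) ((f - g) x))%:E =
    \int[leb]_(x in `]0%R, 1%R[) 0)%E.
  apply: ae_eq_integral => //; first exact: measurable_int I.
  apply: (@filterS _ _ (ae_filter_ringOfSetsType leb) _ _ _ fg) => x /= fgx; rewrite in_itv/= => x01.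
  have -> : (f - g) x = 0 by rewrite -[LHS]/(f x - g x) fgx// subrr.
  by rewrite /dotcv mulmx0 mxE.
by rewrite integral0.
Qed.

Lemma continuous_tensor (a b : R -> R) (D : set (R * R)) : continuous a -> continuous b ->
  {within D, continuous (fun z : R * R => a z.1 * b z.2)}.
Proof.
move=> ca cb; apply: continuous_subspaceT => z; apply: cvgM.
  have h : (fun w : R * R => w.1) w @[w --> z] --> z.1 by exact: cvg_fst.
  exact: (cvg_comp _ _ h (ca z.1)).
have h : (fun w : R * R => w.2) w @[w --> z] --> z.2 by exact: cvg_snd.
exact: (cvg_comp _ _ h (cb z.2)).
Qed.

Context {m p : nat} (lambda : 'rV[R]_(m + p)) (F G : 'M[R]_(m + p)) (nu : R).
Context (y0 : R -> 'cV[R]_(m + p)) (y : R -> R -> 'cV[R]_(m + p)).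
Hypothesis Ly0 : L2_01 y0.
Hypothesis sol : weak_solution lambda F G y0 y.
(** The exponential factor turns decay at rate [nu] into boundedness, and adds [nu] to the adjoint
    generator, whence the scalar matrix in [M]. *)
Let z t := expR (nu * t) *: y t.
Local Notation M := (mulcv (F^T + nu%:M)).
Local Notation N := (snorm (@L2dot R (m + p))).

(** The test function is exp(nu t) psi(x). Its time derivative supplies the term [nu psi], and it
    inherits the adjoint boundary condition because the time factor is a scalar. *)
Lemma weak_semigroup psi chi tau : adj_gen lambda G psi chi -> 0 < tau ->
  L2dot psi (z tau) - L2dot psi y0 =
  \int[leb]_(t in `]0, tau[) L2dot (chi + M psi) (z t).
Proof.
move=> [dpsi [dd dc -> db]] tau0; have [_ _ weak] := sol.
have cpsi := antideriv_cv_cont dd.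
pose e (t : R) := expR (nu * t).
have ce : continuous e := antideriv_continuous (antideriv_expR nu).
have := weak tau (fun t x => e t *: psi x) (fun t x => (nu * e t) *: psi x)
  (fun t x => e t *: dpsi x) tau0.
have -> : \int[leb]_(x in `]0, 1[) dotcv (e tau *: psi x) (y tau x) = L2dot psi (z tau).
  by apply: eq_Rintegral => x _; rewrite dotcvZl -dotcvZr.
have -> : \int[leb]_(x in `]0, 1[) dotcv (e 0 *: psi x) (y0 x) = L2dot psi y0.
  by apply: eq_Rintegral => x _; rewrite /e mulr0 expR0 scale1r.
have -> : \int[leb]_(t in `]0, tau[) \int[leb]_(x in `]0, 1[)
    dotcv ((nu * e t) *: psi x + Lam lambda *m (e t *: dpsi x) + F^T *m (e t *: psi x)) (y t x) =
    \int[leb]_(t in `]0, tau[) L2dot (mulcv (Lam lambda) dpsi + M psi) (z t).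
  apply: eq_Rintegral => t _; apply: eq_Rintegral => x _.
  rewrite dotcvZr -dotcvZl; congr (dotcv _ _).
  have -> : (mulcv (Lam lambda) dpsi + M psi) x =
    Lam lambda *m dpsi x + (F^T + nu%:M) *m psi x by [].
  rewrite mulmxDl mul_scalar_mx -!scalemxAr !scalerDr scalerA [e t * nu]mulrC.
  by rewrite -addrA addrC -addrA.
apply.
- move=> i; split.
  + have -> : (fun z : R * R => (e z.1 *: psi z.2) i 0) =
      (fun z : R * R => e z.1 * psi z.2 i 0) by apply/funext => ?; rewrite mxE.
    exact: (continuous_tensor (a := e) (b := fun x => psi x i 0)).
  + have -> : (fun z : R * R => ((nu * e z.1) *: psi z.2) i 0) =
      (fun z : R * R => (nu * e z.1) * psi z.2 i 0) by apply/funext => ?; rewrite mxE.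
    apply: (continuous_tensor (a := fun t => nu * e t) (b := fun x => psi x i 0)) => //.
    by apply: cont_mul => //; exact: cst_continuous.
  + have -> : (fun z : R * R => (e z.1 *: dpsi z.2) i 0) =
      (fun z : R * R => e z.1 * dpsi z.2 i 0) by apply/funext => ?; rewrite mxE.
    exact: (continuous_tensor (a := e) (b := fun x => dpsi x i 0)).
  + move=> t x _ _; split.
      have -> : (fun s => (e s *: psi x) i 0) = (fun s => psi x i 0 * e s).
        by apply/funext => s; rewrite mxE mulrC.
      apply: is_derive_eq (antideriv_scale (psi x i 0) (antideriv_expR nu) t) _.
      by rewrite mxE mulrC.
    have -> : (fun z => (e t *: psi z) i 0) = (fun z => e t * psi z i 0).
      by apply/funext => s; rewrite mxE.
    by apply: is_derive_eq (antideriv_scale (e t) (dd i) x) _; rewrite mxE.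
- move=> t _; rewrite !linearZ/= -!scale_col_mx -!scalemxAr.
  by congr (_ *: _).
Qed.

Lemma C0_L2_weighted : C0_L2 z.
Proof. by case: sol => cy _ _; exact: C0_L2_scale. Qed.

Lemma weighted_init : N (z 0 - y0) = 0.
Proof.
have [[Ly _] y0E _] := sol.
have -> : z 0 = y 0 by rewrite /z mulr0 expR0 scale1r.
by apply: L2norm_ae0 => //; exact: Ly.
Qed.

Lemma L2dot_init psi : cont_cv psi -> L2dot psi (z 0) = L2dot psi y0.
Proof.
move=> /cont_cv_L2 Lpsi; have Lz := C0_L2_weighted.1 0 (lexx 0).
have Ld := semi_innerB_closed semi_inner_L2 Lz Ly0.
have := semi_inner_CS_abs semi_inner_L2 Lpsi Ld.
rewrite weighted_init mulr0 normr_le0 => /eqP d0.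
rewrite -[z 0](subrK y0) (semi_innerDr semi_inner_L2)//.
by rewrite d0 add0r.
Qed.

(** By the mean value theorem the increment of the pairing is [h] times the pairing of [chi + M psi]
    with [z] at an intermediate time, and uniform continuity moves that time to [t + h]. The
    threshold [eta] does not depend on [psi], as the Euler states vary with the step. *)
Lemma weak_increment T e : 0 < e -> exists2 eta, 0 < eta &
  forall t h, 0 <= t -> 0 < h < eta -> t + h <= T ->
  forall psi chi, adj_gen lambda G psi chi ->
  `|L2dot psi (z (t + h)) - L2dot psi (z t) - h * L2dot (chi + M psi) (z (t + h))|
    <= h * (e * N (chi + M psi)).
Proof.
move=> e0; have [d d0 dP] := C0_L2_uniform T C0_L2_weighted e0; exists d => //.
have [Lz _] := C0_L2_weighted.
move=> t h t0 /andP[h0 hd] thT psi chi A.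
have [cpsi cchi] := adj_gen_cont A.
set w := chi + M psi; have cw : cont_cv w.
  by apply: cont_cvD => //; exact: cont_mulcv.
have Lw := cont_cv_L2 cw.
have diff s s' : 0 <= s -> 0 <= s' ->
    `|L2dot w (z s) - L2dot w (z s')| <= N w * N (z s - z s').
  move=> s0 s'0; have Ls := Lz s s0; have Ls' := Lz s' s'0.
  have Ld := semi_innerB_closed semi_inner_L2 Ls Ls'.
  rewrite -{1}(subrK (z s') (z s)) (semi_innerDr semi_inner_L2)// addrK.
  exact: (semi_inner_CS_abs semi_inner_L2 Lw Ld).
(* Again an even extension, here to obtain an antiderivative on the whole line. *)
have cq : continuous (fun s : R => L2dot w (z `|s|)).
  move=> s; apply/cvgrPdist_lt => r r0.
  have Nw1 : 0 < N w + 1 by rewrite ltr_wpDl// semi_inner_norm_ge0.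
  have [d' d'0 d'P] := C0_L2_at C0_L2_weighted (normr_ge0 s) (divr_gt0 r0 Nw1).
  apply/nbhs_ballP; exists d' => //= s' ss'; rewrite distrC.
  apply: le_lt_trans (diff _ _ (normr_ge0 _) (normr_ge0 _)) _.
  have b := d'P `|s'| (normr_ge0 _) (le_lt_trans (ler_dist_dist s s') ss').
  apply: (@le_lt_trans _ _ (N w * (r / (N w + 1)))).
    by rewrite ler_wpM2l ?semi_inner_norm_ge0// ltW.
  rewrite mulrCA -[ltRHS]mulr1 ltr_pM2l// ltr_pdivrMr// mul1r.
  by rewrite ltrDl.
have [Qd dQ] := exists_antideriv cq.
have QE tau : 0 <= tau -> L2dot psi (z tau) - L2dot psi y0 = Qd tau - Qd 0.
  rewrite le_eqVlt => /predU1P[<-|tau0].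
    by rewrite (L2dot_init cpsi) !subrr.
  rewrite (weak_semigroup A tau0) -(Rintegral_antideriv tau0 cq dQ).
  apply: eq_Rintegral => s; rewrite inE/= in_itv/= => /andP[s0 _].
  by rewrite (gtr0_norm s0).
have th0 : 0 <= t + h by rewrite addr_ge0// ltW.
have -> : L2dot psi (z (t + h)) - L2dot psi (z t) = Qd (t + h) - Qd t.
  have := QE _ th0; have := QE _ t0; lra.
have tth : t < t + h by rewrite ltrDl.
have [xi] := MVT tth (fun s _ => dQ s)
  (continuous_subspaceT (antideriv_continuous dQ)).
rewrite in_itv/= => /andP[txi xith] ->.
have xi0 : 0 <= xi by exact: ltW (le_lt_trans t0 txi).
rewrite addrAC subrr add0r [_ * h]mulrC -mulrBr normrM (gtr0_norm h0).
rewrite ler_wpM2l ?(ltW h0)// (ger0_norm xi0).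
apply: le_trans (diff _ _ xi0 th0) _; rewrite [leRHS]mulrC.
rewrite ler_wpM2l ?semi_inner_norm_ge0// ltW//; apply: dP.
- by rewrite xi0/=; lra.
- by rewrite th0.
- by rewrite ger0_norm; lra.
Qed.

End Weak.

(** * The Lyapunov weight *)

Lemma antideriv_Qweight (R : realType) m p (mu : R) (A : 'M[R]_m) (B : 'M[R]_p) i j :
  antideriv (fun x => Qweight mu A B x i j)
    (fun x => Qweight mu ((2 * mu) *: A) ((- 2 * mu) *: B) x i j).
Proof.
have [i' ->|i' ->] := split_ordP i; have [j' ->|j' ->] := split_ordP j.
- have -> : (fun x => Qweight mu A B x (lshift p i') (lshift p j')) =
      (fun x => A i' j' * expR (2 * mu * x)).
    by apply/funext => x; rewrite block_mxEul mxE mulrC.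
  have -> : (fun x => Qweight mu ((2 * mu) *: A) ((- 2 * mu) *: B) x
        (lshift p i') (lshift p j')) = (fun x => A i' j' * (2 * mu * expR (2 * mu * x))).
    by apply/funext => x; rewrite block_mxEul !mxE; ring.
  exact/antideriv_scale/antideriv_expR.
- have -> : (fun x => Qweight mu A B x (lshift p i') (rshift m j')) = (fun=> 0).
    by apply/funext => x; rewrite block_mxEur mxE.
  have -> : (fun x => Qweight mu ((2 * mu) *: A) ((- 2 * mu) *: B) x
        (lshift p i') (rshift m j')) = (fun=> 0).
    by apply/funext => x; rewrite block_mxEur mxE.
  exact: antideriv_cst.
- have -> : (fun x => Qweight mu A B x (rshift m i') (lshift p j')) = (fun=> 0).
    by apply/funext => x; rewrite block_mxEdl mxE.
  have -> : (fun x => Qweight mu ((2 * mu) *: A) ((- 2 * mu) *: B) x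
        (rshift m i') (lshift p j')) = (fun=> 0).
    by apply/funext => x; rewrite block_mxEdl mxE.
  exact: antideriv_cst.
- have -> : (fun x => Qweight mu A B x (rshift m i') (rshift m j')) =
      (fun x => B i' j' * expR (- 2 * mu * x)).
    by apply/funext => x; rewrite block_mxEdr mxE mulrC.
  have -> : (fun x => Qweight mu ((2 * mu) *: A) ((- 2 * mu) *: B) x
        (rshift m i') (rshift m j')) = (fun x => B i' j' * (- 2 * mu * expR (- 2 * mu * x))).
    by apply/funext => x; rewrite block_mxEdr !mxE; ring.
  exact/antideriv_scale/antideriv_expR.
Qed.

Section Lyapunov.
Context {R : realType} {m p : nat} (lambda : 'rV[R]_(m + p)).
Hypothesis lambda_neg : forall k : 'I_m, lambda 0 (lshift p k) < 0.
Hypothesis lambda_pos : forall k : 'I_p, 0 < lambda 0 (rshift m k).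
Variables (F : 'M[R]_(m + p)).
Variables (Gmm : 'M[R]_m) (Gmp : 'M[R]_(m, p)) (Gpm : 'M[R]_(p, m)) (Gpp : 'M[R]_p).
Variables (nu mu : R) (Qm : 'M[R]_m) (Qp : 'M[R]_p).
Hypotheses (Qm_posdef : posdef Qm) (Qp_posdef : posdef Qp).
Hypothesis Q_comm : forall x : R, 0 <= x <= 1 ->
  Qweight mu Qm Qp x *m Lam lambda = Lam lambda *m Qweight mu Qm Qp x.
Local Notation Dm := (diag_mx (- lsubmx lambda)).
Local Notation Dp := (diag_mx (rsubmx lambda)).
Local Notation P := (Qweight (- mu) (invmx Qm) (invmx Qp)).

Lemma Lam_block : Lam lambda = block_mx (- Dm) 0 0 Dp.
Proof. by rewrite /Lam -{1}[lambda]hsubmxK diag_mx_row [diag_mx (- _)]linearN opprK. Qed.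

Lemma Lam_plus_block : Lam_plus lambda = block_mx Dm 0 0 Dp.
Proof.
rewrite /Lam_plus -diag_mx_row; congr diag_mx; apply/rowP => k.
rewrite mxE; case: (splitP k) => j kj.
  have -> : k = lshift p j by apply: val_inj.
  by rewrite row_mxEl !mxE ltr0_norm.
have -> : k = rshift m j by apply: val_inj.
by rewrite row_mxEr !mxE gtr0_norm.
Qed.

(** At [x = 0] the exponentials equal 1, and the block form splits the commutation. *)
Lemma Q_comm0 : Qm *m Dm = Dm *m Qm /\ Qp *m Dp = Dp *m Qp.
Proof.
have := Q_comm (x := 0); rewrite lexx ler01 => /(_ isT).
rewrite /Qweight !mulr0 expR0 !scale1r Lam_block !mulmx_block.
rewrite !mulmx0 !mul0mx !addr0 !add0r => /eq_block_mx[+ _ _ ->].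
by rewrite mulmxN mulNmx => /oppr_inj ->.
Qed.

(** [Qm] is allowed to be non-diagonal; it is the commutation with the speeds that makes the product
    symmetric and nonnegative. This form and the next measure the boundary flux of energy. *)
Lemma psd_QmDm : possemidef (Qm *m Dm).
Proof.
apply: psd_mul_diag; [exact: posdef_psd|move=> i|exact: Q_comm0.1].
by rewrite !mxE oppr_gt0.
Qed.

Lemma psd_QpDp : possemidef (Qp *m Dp).
Proof.
apply: psd_mul_diag; [exact: posdef_psd|move=> i|exact: Q_comm0.2].
by rewrite !mxE.
Qed.

Lemma invmx_comm n (A B : 'M[R]_n) : A \in unitmx -> A *m B = B *m A ->
  invmx A *m B = B *m invmx A.
Proof.
move=> uA AB; apply: (can_inj (mulKmx uA)); rewrite mulKVmx// mulmxA AB.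
by rewrite -mulmxA mulmxV// mulmx1.
Qed.

Lemma dual_weightK x : P x *m Qweight mu Qm Qp x = 1%:M.
Proof. by rewrite mulmx1C// Qweight_mulV. Qed.

Lemma dual_weight_Lam_plus_comm x : P x *m Lam_plus lambda = Lam_plus lambda *m P x.
Proof.
have [cm cp] := Q_comm0.
rewrite Lam_plus_block /Qweight !mulmx_block !mulmx0 !mul0mx !addr0 !add0r.
rewrite -!scalemxAl -!scalemxAr (invmx_comm (posdef_unit Qm_posdef) cm).
by rewrite (invmx_comm (posdef_unit Qp_posdef) cp).
Qed.

Lemma dual_weight_Lam_comm x : P x *m Lam lambda = Lam lambda *m P x.
Proof.
have [cm cp] := Q_comm0.
rewrite Lam_block /Qweight !mulmx_block !mulmx0 !mul0mx !addr0 !add0r.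
rewrite mulmxN mulNmx.
rewrite -!scalemxAl -!scalemxAr (invmx_comm (posdef_unit Qm_posdef) cm).
by rewrite (invmx_comm (posdef_unit Qp_posdef) cp).
Qed.

Lemma dual_weight_sym x : (P x)^T = P x.
Proof. by case: (Qweight_psd (- mu) x (posdef_inv Qm_posdef) (posdef_inv Qp_posdef)). Qed.

(** * Dual inequalities, dissipativity and the resolvent *)

Hypothesis Q_interior : forall x : R, 0 <= x <= 1 ->
  loewner_le
    ((- 2 * mu) *: (Qweight mu Qm Qp x *m Lam_plus lambda)
       + F^T *m Qweight mu Qm Qp x + Qweight mu Qm Qp x *m F)
    ((- 2 * nu) *: Qweight mu Qm Qp x).

(** Congruence by the inverse weight: the interior inequality is evaluated at [w = P x *m v], so
    that Q w = v, and the two terms in [F] both become the pairing of [v] with [P x *m F^T *m v]. *)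
Lemma dual_interior x v : 0 <= x <= 1 ->
  dotcv v (P x *m (F^T + nu%:M) *m v) <= mu * dotcv v (P x *m Lam_plus lambda *m v).
Proof.
move=> x01; have [_] := Q_interior x01; set Q := Qweight mu Qm Qp x.
set w := P x *m v => /(_ w).
have Qw : Q *m w = v by rewrite /w mulmxA Qweight_mulV// mul1mx.
have sQ : Q^T = Q by case: (Qweight_psd mu x Qm_posdef Qp_posdef).
have Psw u : dotcv w u = dotcv v (P x *m u) by rewrite /w dotcvC dotcv_sym ?dual_weight_sym.
rewrite mulmxBl dotcvBr subr_ge0 !mulmxDl !dotcvDr -!scalemxAl !dotcvZr -!mulmxA Qw.
have -> : dotcv w (Q *m (Lam_plus lambda *m w)) =
    dotcv v (P x *m Lam_plus lambda *m v).
  by rewrite dotcv_sym// Qw dotcvC /w mulmxA -dual_weight_Lam_plus_comm.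
have -> : dotcv w (Q *m (F *m w)) = dotcv v (P x *m (F^T *m v)).
  by rewrite dotcv_mulmx sQ Qw dotcv_mulmx dotcvC Psw.
rewrite !Psw mulmxDl mulmxDr dotcvDr mul_scalar_mx -scalemxAr dotcvZr !mulmxA.
lra.
Qed.

Hypothesis Q_boundary :
  loewner_le
    ((block_mx 1%:M 0 Gpm Gpp)^T *m (Qweight mu Qm Qp 0 *m Lam lambda)
       *m block_mx 1%:M 0 Gpm Gpp)
    ((block_mx Gmm Gmp 0 1%:M)^T *m (Qweight mu Qm Qp 1 *m Lam lambda)
       *m block_mx Gmm Gmp 0 1%:M).

Lemma QLam_form x (a : 'cV[R]_m) (b : 'cV[R]_p) :
  dotcv (col_mx a b) (Qweight mu Qm Qp x *m Lam lambda *m col_mx a b) =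
  - expR (2 * mu * x) * dotcv a (Qm *m Dm *m a)
  + expR (- 2 * mu * x) * dotcv b (Qp *m Dp *m b).
Proof.
rewrite -mulmxA Lam_block mul_block_col !mul0mx addr0 add0r Qweight_mul_col.
rewrite dotcv_col !dotcvZr mulNmx mulmxN -scaleN1r dotcvZr -!mulmxA; ring.
Qed.

(** A contraction has a contractive adjoint. In the squared norms given by [Qm *m Dm] and
    [Qp *m Dp], [Q_boundary] reads e^(2mu)|am|^2 + |ap|^2 <= |vm|^2 + e^(-2mu)|vp|^2, while the
    claim is |vm|^2 + e^(-2mu)|vp|^2 <= e^(2mu)|um'|^2 + |up'|^2. The adjoint condition paired with
    (vm, vp) equates the middle quantity with the pairing of (am, ap) and (um', up'). *)
Lemma dual_boundary psi0 psi1 :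
  Lam_plus lambda *m col_mx (usubmx psi0) (dsubmx psi1) =
    (block_mx Gmm Gmp Gpm Gpp)^T *m Lam_plus lambda *m
      col_mx (usubmx psi1) (dsubmx psi0) ->
  dotcv psi1 (P 1 *m Lam lambda *m psi1) <= dotcv psi0 (P 0 *m Lam lambda *m psi0).
Proof.
have [cm cp] := Q_comm0.
have [um up] := (posdef_unit Qm_posdef, posdef_unit Qp_posdef).
pose w0 := P 0 *m psi0; pose w1 := P 1 *m psi1.
pose vm := usubmx w0; pose up' := dsubmx w0.
pose um' := usubmx w1; pose vp := dsubmx w1.
have form x psi w : psi = Qweight mu Qm Qp x *m w ->
    dotcv psi (P x *m Lam lambda *m psi) =
    dotcv w (Qweight mu Qm Qp x *m Lam lambda *m w).
  move=> ->; rewrite dual_weight_Lam_comm -!mulmxA (mulmxA (P x)) dual_weightK mul1mx.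
  by rewrite [RHS]dotcv_mulmx (proj1 (Qweight_psd mu x Qm_posdef Qp_posdef)).
have E0 : psi0 = Qweight mu Qm Qp 0 *m w0 by rewrite /w0 mulmxA Qweight_mulV// mul1mx.
have E1 : psi1 = Qweight mu Qm Qp 1 *m w1 by rewrite /w1 mulmxA Qweight_mulV// mul1mx.
rewrite (form _ _ _ E0) (form _ _ _ E1).
rewrite {}E0 {}E1 -[w0]vsubmxK -[w1]vsubmxK -/vm -/up' -/um' -/vp.
rewrite !QLam_form !Qweight_mul_col !col_mxKu !col_mxKd.
rewrite !mulr0 !mulr1 expR0 !scale1r => adj.
(* [Q_boundary] is used at the outgoing traces (vm, vp) of [P psi], mapped by G to (am, ap);
   then AM-GM against the incoming traces (um', up'). *)
pose am := Gmm *m vm + Gmp *m vp; pose ap := Gpm *m vm + Gpp *m vp.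
have [_ /(_ (col_mx vm vp))] := Q_boundary.
rewrite mulmxBl dotcvBr subr_ge0.
rewrite -!(mulmxA (_^T)) !(dotcv_mulmx _ (_^T)) !trmxK -!(mulmxA _ (block_mx _ _ _ _)).
rewrite !mul_block_col !mul0mx !mul1mx addr0 add0r -/am -/ap.
rewrite !QLam_form !mulr0 !mulr1 expR0 => Qb.
have := congr1 (dotcv (col_mx vm vp)) adj.
rewrite -mulmxA (dotcv_mulmx _ (_^T)) trmxK Lam_plus_block !mul_block_col !mul0mx !addr0 !add0r.
rewrite -/am -/ap !dotcv_col -!scalemxAr !dotcvZr.
rewrite !mulmxA -cm -cp => adjv.
have h1 := psd_amgm am um' psd_QmDm; have h2 := psd_amgm ap up' psd_QpDp.
have e0 := ler_wpM2l (expR_ge0 (2 * mu)) h1.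
move: adjv Qb e0 h2; lra.
Qed.

Lemma dual_weight_Lam x :
  P x *m Lam lambda = Qweight (- mu) (invmx Qm *m - Dm) (invmx Qp *m Dp) x.
Proof.
rewrite Lam_block /Qweight mulmx_block !mulmx0 !mul0mx !addr0 !add0r.
by rewrite -!scalemxAl.
Qed.

(** The blocks of [P] have opposite exponents and those of [Lam lambda] opposite signs. The signs
    cancel on differentiation, and the absolute speeds of the interior inequality appear. *)
Lemma deriv_dual_weight_Lam x : Qweight (- mu) ((2 * - mu) *: (invmx Qm *m - Dm))
    ((- 2 * - mu) *: (invmx Qp *m Dp)) x = (2 * mu) *: (P x *m Lam_plus lambda).
Proof.
rewrite Lam_plus_block /Qweight mulmx_block !mulmx0 !mul0mx !addr0 !add0r.
rewrite scale_block_mx !scaler0 -!scalemxAl !scalerA mulmxN scalerN -scaleNr.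
by congr block_mx; congr (_ *: _); ring.
Qed.

Lemma cont_dual_weight : cont_mx P.
Proof. by move=> i j; apply: antideriv_continuous (antideriv_Qweight _ _ _ i j). Qed.

Local Notation G := (block_mx Gmm Gmp Gpm Gpp).
Local Notation M := (mulcv (F^T + nu%:M)).

(** Integration by parts for E = psi.(P Lam psi): its derivative is 2 psi.(P Lam psi') + 2 mu psi.(P
    Lam_plus psi), and by [dual_interior] the last term dominates 2 psi.(P M psi). Thus twice the
    form is at most E(1) - E(0), which [dual_boundary] makes nonpositive. *)
Lemma adj_gen_dissipative psi chi : adj_gen lambda G psi chi ->
  Wdot P psi (chi + M psi) <= 0.
Proof.
move=> [d [dd dc -> db]].
have cpsi := antideriv_cv_cont dd.
pose W x := P x *m Lam lambda.
pose W' x := (2 * mu) *: (P x *m Lam_plus lambda).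
have dW i j : antideriv (fun x => W x i j) (fun x => W' x i j).
  have -> : (fun x => W x i j) = (fun x => Qweight (- mu) (invmx Qm *m - Dm)
      (invmx Qp *m Dp) x i j) by apply/funext => x; rewrite /W dual_weight_Lam.
  have -> : (fun x => W' x i j) = (fun x => Qweight (- mu)
      ((2 * - mu) *: (invmx Qm *m - Dm)) ((- 2 * - mu) *: (invmx Qp *m Dp)) x i j).
    by apply/funext => x; rewrite /W' deriv_dual_weight_Lam.
  exact: antideriv_Qweight.
have cW : cont_mx W by move=> i j; apply: antideriv_continuous (dW i j).
have cW' : cont_mx W'.
  move=> i j; have -> : (fun x => W' x i j) = (fun x => Qweight (- mu)
      ((2 * - mu) *: (invmx Qm *m - Dm)) ((- 2 * - mu) *: (invmx Qp *m Dp)) x i j).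
    by apply/funext => x; rewrite /W' deriv_dual_weight_Lam.
  exact: antideriv_continuous (antideriv_Qweight _ _ _ i j).
have dE := antideriv_dotcv dd (antideriv_mulmx dW dd).
set E := (fun x => dotcv _ _) in dE; set E' := (fun x => _ + _) in dE.
have cE' : continuous E'.
  apply: cont_add; apply: cont_dotcv => //; first exact: cont_cv_mulmx.
  by apply: cont_cvD; exact: cont_cv_mulmx.
have E10 : E 1 - E 0 <= 0 by rewrite subr_le0; exact: dual_boundary.
rewrite -(pmulr_rle0 _ (@ltr0Sn R 1)); apply: le_trans E10.
rewrite -(Rintegral_antideriv ltr01 cE' dE).
have c1 : continuous (fun x => dotcv (psi x) (P x *m (mulcv (Lam lambda) d + M psi) x)).
  apply: cont_dotcv => //; apply: cont_cv_mulmx; first exact: cont_dual_weight.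
  by apply: cont_cvD; apply: cont_mulcv.
rewrite /Wdot -RintegralZl//; last exact: continuous_integrable01.
apply: le_Rintegral => //.
- by apply: integrable01Z; apply: continuous_integrable01.
- exact: continuous_integrable01.
move=> x /=; rewrite in_itv/= => /andP[/ltW x0 /ltW x1].
have x01 : 0 <= x <= 1 by rewrite x0.
have int := dual_interior (psi x) x01.
have sW : (W x)^T = W x.
  by rewrite /W trmx_mul dual_weight_sym dual_weight_Lam_comm /Lam tr_diag_mx.
rewrite /E' (dotcv_sym (d x) (psi x) sW) dotcvDr /W' -scalemxAl dotcvZr.
have -> : (mulcv (Lam lambda) d + M psi) x = Lam lambda *m d x + (F^T + nu%:M) *m psi x by [].
rewrite mulmxDr dotcvDr !mulmxA /W; move: int.
lra.
Qed.

Lemma semi_inner_dual_weight : semi_inner cont_cv (Wdot P).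
Proof.
apply: semi_inner_W; first exact: cont_dual_weight.
by move=> x _; apply: Qweight_psd; exact: posdef_inv.
Qed.

Lemma integrable_dual_weight f g : cont_cv f -> cont_cv g ->
  (@lebesgue_measure R).-integrable `]0, 1[ (EFin \o (fun x => dotcv (f x) (P x *m g x))).
Proof.
move=> cf cg; apply: continuous_integrable01; apply: cont_dotcv => //.
by apply: cont_cv_mulmx => //; exact: cont_dual_weight.
Qed.

Lemma cont_integrable_dotcv n (f g : R -> 'cV[R]_n) : cont_cv f -> cont_cv g ->
  (@lebesgue_measure R).-integrable `]0, 1[ (EFin \o (fun x => dotcv (f x) (g x))).
Proof. by move=> cf cg; apply: continuous_integrable01; exact: cont_dotcv. Qed.

Lemma L2dot_le_Wdot : exists2 K, 0 < K &
  forall psi, cont_cv psi -> L2dot psi psi <= K * Wdot P psi psi.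
Proof.
have [K K0 bK] := Qweight_inv_lower mu Qm_posdef Qp_posdef; exists K => // psi cpsi.
rewrite /Wdot -RintegralZl//; last exact: integrable_dual_weight.
apply: le_Rintegral => //; [exact: cont_integrable_dotcv|exact/integrable01Z/integrable_dual_weight|].
move=> x /=; rewrite in_itv/= => /andP[/ltW x0 /ltW x1].
by apply: bK; rewrite x0.
Qed.

Lemma Wdot_le_L2dot : exists2 K, 0 < K &
  forall psi, cont_cv psi -> Wdot P psi psi <= K * L2dot psi psi.
Proof.
have [K K0 bK] := Qweight_upper (- mu) (posdef_inv Qm_posdef) (posdef_inv Qp_posdef).
exists K => // psi cpsi.
rewrite /L2dot -RintegralZl//; last exact: cont_integrable_dotcv.
apply: le_Rintegral => //; [exact: integrable_dual_weight|exact/integrable01Z/cont_integrable_dotcv|].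
move=> x /=; rewrite in_itv/= => /andP[/ltW x0 /ltW x1].
by apply: bK; rewrite x0.
Qed.

Lemma mulcv_bounded (B : 'M[R]_(m + p)) : exists2 c, 0 <= c &
  forall psi, cont_cv psi -> snorm (Wdot P) (mulcv B psi) <= c * snorm (Wdot P) psi.
Proof.
have [K1 K10 b1] := L2dot_le_Wdot; have [K2 K20 b2] := Wdot_le_L2dot.
have [K3 K30 b3] := mulmx_bound B.
exists (Num.sqrt (K2 * (K3 * K1))); first exact: sqrtr_ge0.
have K'0 : 0 <= K2 * (K3 * K1) by rewrite !mulr_ge0// ltW.
move=> psi cpsi; rewrite /snorm -sqrtrM//.
apply: ler_wsqrtr; apply: le_trans (b2 _ (cont_mulcv (A := B) cpsi)) _.
rewrite -2!mulrA ler_wpM2l ?(ltW K20)//.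
apply: (@le_trans _ _ (K3 * L2dot psi psi)); last by rewrite ler_wpM2l// b1.
rewrite /L2dot -RintegralZl//; last exact: cont_integrable_dotcv.
apply: le_Rintegral => [//|||x _]; last exact: b3.
  by apply: cont_integrable_dotcv; exact: cont_mulcv.
exact/integrable01Z/cont_integrable_dotcv.
Qed.

Lemma lambda_neq0 i : lambda 0 i != 0.
Proof.
have [j ->|j ->] := split_ordP i; first by rewrite lt_eqF// lambda_neg.
by rewrite gt_eqF// lambda_pos.
Qed.

(* For small h, dissipativity excludes nontrivial homogeneous solutions. *)
Lemma adj_gen_resolvent : exists2 h0, 0 < h0 & forall h, 0 < h < h0 ->
  forall g, cont_cv g -> exists psi chi, adj_gen lambda G psi chi /\ psi - h *: chi = g.
Proof.
have [c c0 bc] := mulcv_bounded (F^T + nu%:M).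
have [K K0 bK] := L2dot_le_Wdot.
exists (c + 1)^-1; first by rewrite invr_gt0 ltr_wpDl.
move=> h /andP[h0 hc] g cg; apply: adj_gen_solvable => //.
  by move=> i; rewrite mulf_neq0 ?lambda_neq0// gt_eqF.
move=> psi chi A /eqP; rewrite subr_eq0 => /eqP E.
have [cpsi cchi] := adj_gen_cont A; have cM := cont_mulcv (A := F^T + nu%:M) cpsi.
have := adj_gen_dissipative A; rewrite (semi_innerDr semi_inner_dual_weight)// => diss.
have CS := semi_inner_CS semi_inner_dual_weight (semi_innerZ_closed semi_inner_dual_weight (-1) cpsi) cM.
rewrite (semi_innerZl semi_inner_dual_weight)// (semi_inner_normZ semi_inner_dual_weight)// in CS.
rewrite normrN1 mul1r mulN1r in CS.
have N0 := semi_inner_norm_ge0 (Wdot P) psi.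
have E2 : Wdot P psi psi = h * Wdot P psi chi.
  by rewrite {2}E (semi_innerZr semi_inner_dual_weight).
have sqN := semi_inner_sqr semi_inner_dual_weight cpsi.
(* With N the norm of [psi]: N^2 = h <psi, chi> <= - h <psi, M psi> <= h c N^2, and h c < 1 by the
   choice of the threshold. *)
have le0 : Wdot P psi psi <= 0.
  have hc1 : h * c < 1.
    have : h * (c + 1) < 1 by rewrite -ltr_pdivlMr ?ltr_wpDl// mul1r.
    by rewrite mulrDr mulr1; lra.
  have h1 := ler_wpM2l (ltW h0) diss; have h2 := ler_wpM2l (ltW h0) CS.
  have h3 := ler_wpM2l N0 (bc _ cpsi); have h4 := ler_wpM2l (ltW h0) h3.
  have h5 : (1 - h * c) * Wdot P psi psi <= 0.
    rewrite -sqN in E2 h1 h2 h3 h4 *.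
    move: E2 h1 h2 h4; rewrite mulr0 mulrDr; set N := snorm _ _; set q := snorm _ _.
    by rewrite expr2; move: (Wdot _ _ _) => w1; move: (Wdot _ _ _) => w2; lra.
  by move: h5; rewrite pmulr_rle0// subr_gt0.
apply: le_trans (bK _ cpsi) _.
by rewrite pmulr_rle0.
Qed.

Lemma weak_decay : exists2 K, 0 <= K & forall y0 y T,
  L2_01 y0 -> weak_solution lambda F G y0 y -> 0 < T ->
  forall psi chi, adj_gen lambda G psi chi ->
  `|L2dot psi (expR (nu * T) *: y T)| <= K * L2norm y0 * snorm (Wdot P) psi.
Proof.
have [K K0 bK] := L2dot_le_Wdot; have [c c0 bc] := mulcv_bounded (F^T + nu%:M).
have [h0 h00 res] := adj_gen_resolvent.
exists (Num.sqrt K); first exact: sqrtr_ge0.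
move=> y0 y T Ly0 sol T0 psi chi A.
have Cz := C0_L2_weighted nu sol; have [Lz _] := Cz.
set z := (fun t => expR (nu * t) *: y t) in Cz Lz.
have [Y Y0 bY] := C0_L2_bounded Cz (ltW T0).
have NK w : cont_cv w -> snorm (@L2dot R _) w <= Num.sqrt K * snorm (Wdot P) w.
  move=> cw; rewrite /snorm -sqrtrM ?(ltW K0)//.
  by apply: ler_wsqrtr; exact: bK.
have pb f w B : L2_01 f -> cont_cv w -> snorm (@L2dot R _) f <= B ->
    `|L2dot w f| <= Num.sqrt K * B * snorm (Wdot P) w.
  move=> Lf cw fB; have Lw := cont_cv_L2 cw.
  apply: le_trans (semi_inner_CS_abs semi_inner_L2 Lw Lf) _.
  rewrite mulrAC; apply: ler_pM => //; first exact: semi_inner_norm_ge0.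
    exact: semi_inner_norm_ge0.
  exact: NK.
have := @euler_bound R _ cont_cv (Wdot P) semi_inner_dual_weight (adj_gen lambda G) M c h0 T
  (Num.sqrt K * Y) (Num.sqrt K * L2norm y0) (fun psi t => L2dot psi (z t)).
move=> EB; apply: (EB _ _ _ _ _ _ _ _ _ _ _ _ _ _ _ _ _ _ A) => //.
- exact: adj_gen_cont.
- exact: adj_gen_B.
- by move=> f g; apply/funext => x; rewrite /mulcv mulmxBr.
- by move=> f; exact: cont_mulcv.
- exact: adj_gen_dissipative.
- by rewrite mulr_ge0// sqrtr_ge0.
- by rewrite mulr_ge0// sqrtr_ge0.
- move=> a f g t t0 /cont_cv_L2 Lf /cont_cv_L2 Lg; have Lzt := Lz t t0.
  rewrite (semi_innerDl semi_inner_L2)//; last exact: (semi_innerZ_closed semi_inner_L2).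
  by rewrite (semi_innerZl semi_inner_L2).
- move=> t w tT cw; apply: pb => //; last exact: bY.
  by apply: Lz; case/andP: tT.
- move=> w cw; have -> : L2dot w (z 0) = L2dot w y0 := L2dot_init nu Ly0 sol cw.
  exact: pb.
(* Division by [Num.sqrt K] converts the L^2 norm of [weak_increment] into the weighted norm of the
   Euler scheme. *)
- move=> e e0; have sK0 : 0 < Num.sqrt K by rewrite sqrtr_gt0.
  have [eta eta0 inc] := weak_increment nu Ly0 sol T (divr_gt0 e0 sK0).
  exists eta => // t h t0 hh thT s x sx.
  apply: le_trans (inc t h t0 hh thT s x sx) _.
  rewrite -mulrA ler_wpM2l//; first by case/andP: hh => /ltW.
  rewrite mulrAC ler_pdivrMr// -mulrA ler_wpM2l ?(ltW e0)// mulrC.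
  have [cs cx] := adj_gen_cont sx; apply: NK.
  by apply: cont_cvD => //; exact: cont_mulcv.
Qed.

(** A scalar C^1 function vanishing at both end points, placed in coordinate [i], has zero traces;
    it therefore satisfies the adjoint boundary condition whatever [G] is, and density can be
    applied one coordinate at a time. *)
Lemma coord_decay : exists2 K, 0 <= K & forall y0 y T i,
  L2_01 y0 -> weak_solution lambda F G y0 y -> 0 < T ->
  snorm sdot (fun x => (expR (nu * T) *: y T) x i 0) <= K * L2norm y0.
Proof.
have [K1 K10 dec] := weak_decay; have [K2 K20 b2] := Wdot_le_L2dot.
exists (K1 * Num.sqrt K2); first by rewrite mulr_ge0// sqrtr_ge0.
move=> y0 y T i Ly0 sol T0; have Lz := (C0_L2_weighted nu sol).1 T (ltW T0).
have N0 : 0 <= L2norm y0 by exact: sqrtr_ge0.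
apply: snorm_le_of_C1_pairing => //; first by rewrite !mulr_ge0// sqrtr_ge0.
move=> g cg g0 g1; have cgc := C1_continuous cg; case: cg => dg ag cdg.
pose psi x : 'cV[R]_(m + p) := g x *: delta_mx i 0.
pose dpsi x : 'cV[R]_(m + p) := dg x *: delta_mx i 0.
have coordE (f : R -> R) j : (fun x => (f x *: (delta_mx i 0 : 'cV[R]_(m + p))) j 0) =
    (fun x => (j == i)%:R * f x).
  by apply/funext => x; rewrite !mxE eqxx andbT mulrC.
have dpsiP : antideriv_cv psi dpsi.
  by move=> j; rewrite /psi /dpsi !coordE; exact: antideriv_scale.
have cpsi := antideriv_cv_cont dpsiP.
have A : adj_gen lambda G psi (mulcv (Lam lambda) dpsi).
  exists dpsi; split => //.
    move=> j; rewrite /dpsi coordE; apply: cont_mul => //; exact: cst_continuous.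
  have -> : out_trace psi = 0.
    apply/colP => j; rewrite out_trace_coord /psi.
    by case: (~~ _); rewrite ?g0 ?g1 scale0r !mxE.
  have -> : in_trace psi = 0.
    apply/colP => j; rewrite in_trace_coord /psi.
    by case: (j < m)%N; rewrite ?g0 ?g1 scale0r !mxE.
  by rewrite !mulmx0.
have dotE (a : R) (v : 'cV[R]_(m + p)) : dotcv (a *: delta_mx i 0) v = a * v i 0.
  rewrite dotcvZl dotcvE (bigD1 i)//= big1 ?addr0; last first.
    by move=> j ji; rewrite mxE (negbTE ji) mul0r.
  by rewrite mxE !eqxx mul1r.
have := dec y0 y T Ly0 sol T0 psi _ A.
have -> : L2dot psi (expR (nu * T) *: y T) =
    sdot g (fun x => (expR (nu * T) *: y T) x i 0).
  by apply: eq_Rintegral => x _; rewrite dotE.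
have : snorm (Wdot P) psi <= Num.sqrt K2 * snorm sdot g.
  rewrite /snorm -sqrtrM ?(ltW K20)//; apply: ler_wsqrtr.
  apply: le_trans (b2 _ cpsi) _; rewrite ler_wpM2l ?(ltW K20)//.
  rewrite le_eqVlt; apply/orP; left; apply/eqP.
  by apply: eq_Rintegral => x _; rewrite dotE !mxE !eqxx mulr1.
move=> /(ler_wpM2l (mulr_ge0 K10 N0)) h1 h2; rewrite /pairing_le.
apply: le_trans (ler_norm _) _; apply: le_trans h2 _; apply: le_trans h1 _.
by rewrite le_eqVlt; apply/orP; left; apply/eqP; ring.
Qed.

Lemma exponential_decay : exists C, 0 < C /\ forall y0, L2_01 y0 ->
  forall y, weak_solution lambda F G y0 y -> forall t, 0 <= t ->
  L2norm (y t) <= C * expR (- nu * t) * L2norm y0.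
Proof.
have [K K0 dec] := coord_decay.
(* The square root comes from summing [m + p] squared coordinate bounds. The added 1 makes the
   constant positive and covers [t = 0], where [coord_decay] does not apply and the initial
   condition is used. *)
exists (Num.sqrt (m + p)%:R * K + 1); split; first by rewrite ltr_wpDl// mulr_ge0// sqrtr_ge0.
move=> y0 Ly0 y sol t t0; have N0 : 0 <= L2norm y0 by exact: sqrtr_ge0.
have sK : 0 <= Num.sqrt (m + p)%:R * K by rewrite mulr_ge0// sqrtr_ge0.
have Lyt : L2_01 (y t) by case: sol => -[Ly _] _ _; exact: Ly.
have Lz := (C0_L2_weighted nu sol).1 t t0.
suff H : snorm (@L2dot R _) (expR (nu * t) *: y t) <= (Num.sqrt (m + p)%:R * K + 1) * L2norm y0.
  move: H; rewrite (semi_inner_normZ semi_inner_L2)// (ger0_norm (expR_ge0 _)).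
  rewrite mulNr expRN mulrAC -ler_pdivlMl ?expR_gt0// mulrC.
  by rewrite [_ / _]mulrC [X in _ <= X]mulrC.
move: t0; rewrite le_eqVlt => /predU1P[t0|t0].
  rewrite -t0; have := weighted_init nu Ly0 sol => z0.
  have Lz0 := (C0_L2_weighted nu sol).1 0 (lexx 0).
  have := semi_inner_normD semi_inner_L2 (semi_innerB_closed semi_inner_L2 Lz0 Ly0) Ly0.
  rewrite subrK z0 add0r => /le_trans; apply.
  by rewrite ler_peMl// lerDr.
apply: (@le_trans _ _ (Num.sqrt (m + p)%:R * K * L2norm y0)); last first.
  by rewrite ler_wpM2r// lerDl.
have -> : Num.sqrt (m + p)%:R * K * L2norm y0 = Num.sqrt ((m + p)%:R * (K * L2norm y0) ^+ 2).
  by rewrite sqrtrM// sqrtr_sqr ger0_norm ?mulr_ge0// mulrA.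
apply: ler_wsqrtr.
set f := expR _ *: _.
have -> : L2dot f f = \sum_i sdot (fun x => f x i 0) (fun x => f x i 0).
  rewrite -Rintegral01_sum => [|i]; first by apply: eq_Rintegral => x _; rewrite dotcvE.
  by apply: integrable_mul_sqr; case: (Lz i).
rewrite mulr_natl -[X in _ *+ X]card_ord -sumr_const; apply: ler_sum => i _.
have si : sqint01 (fun x => f x i 0) by exact: Lz i.
rewrite -(semi_inner_sqr semi_inner_sdot si) ler_sqr ?nnegrE ?semi_inner_norm_ge0//.
  exact: dec.
by rewrite mulr_ge0.
Qed.

End Lyapunov.

Theorem mainTheorem1 (R : realType) (m p : nat)
    (lambda : 'rV[R]_(m + p))
    (lambda_neg : forall k : 'I_m, lambda 0 (lshift p k) < 0)
    (lambda_pos : forall k : 'I_p, 0 < lambda 0 (rshift m k))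
    (F : 'M[R]_(m + p))
    (Gmm : 'M[R]_m) (Gmp : 'M[R]_(m, p)) (Gpm : 'M[R]_(p, m)) (Gpp : 'M[R]_p)
    (nu mu : R) (Qm : 'M[R]_m) (Qp : 'M[R]_p)
    (nu_gt0 : 0 < nu) (Qm_posdef : posdef Qm) (Qp_posdef : posdef Qp)
    (Q_comm : forall x : R, 0 <= x <= 1 ->
       Qweight mu Qm Qp x *m Lam lambda = Lam lambda *m Qweight mu Qm Qp x)
    (Q_interior : forall x : R, 0 <= x <= 1 ->
       loewner_le
         ((- 2 * mu) *: (Qweight mu Qm Qp x *m Lam_plus lambda)
            + F^T *m Qweight mu Qm Qp x + Qweight mu Qm Qp x *m F)
         ((- 2 * nu) *: Qweight mu Qm Qp x))
    (Q_boundary :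
       loewner_le
         ((block_mx 1%:M 0 Gpm Gpp)^T *m (Qweight mu Qm Qp 0 *m Lam lambda)
            *m block_mx 1%:M 0 Gpm Gpp)
         ((block_mx Gmm Gmp 0 1%:M)^T *m (Qweight mu Qm Qp 1 *m Lam lambda)
            *m block_mx Gmm Gmp 0 1%:M)) :
  (exists C : R, 0 < C /\
     forall y0 : R -> 'cV[R]_(m + p), L2_01 y0 ->
     forall y : R -> R -> 'cV[R]_(m + p),
       weak_solution lambda F (block_mx Gmm Gmp Gpm Gpp) y0 y ->
     forall t : R, 0 <= t ->
       L2norm (y t) <= C * expR (- nu * t) * L2norm y0) /\
  GES lambda F (block_mx Gmm Gmp Gpm Gpp).
Proof.
have decay := exponential_decay lambda_neg lambda_pos Qm_posdef Qp_posdef Q_comm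
  Q_interior Q_boundary.
by split=> //; have [C [C_gt0 C_decay]] := decay; exists nu, C.
Qed.
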